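(* Let $\mathcal{N}$ be a complex nilpotent Lie superalgebra of maximal rank and let $\mathcal{R}=\mathcal{R}_0\oplus\mathcal{R}_1$ be a non-nilpotent maximal solvable extension of $\mathcal{N}$ satisfying $[\mathcal{R},\mathcal{R}]\subseteq\mathcal{N}$ and $[\mathcal{R}_1,\mathcal{R}_1]\subseteq[\mathcal{R}_0,\mathcal{R}_0]$. Then $\mathcal{R}$ has trivial center, and every superderivation of $\mathcal{R}$ is inner.
   Context: All spaces are finite-dimensional over $\mathbb{C}$. A Lie superalgebra $\mathcal{L}=\mathcal{L}_0\oplus\mathcal{L}_1$ is a $\mathbb{Z}_2$-graded vector space with an even bilinear bracket satisfying super skew-symmetry and the super Jacobi identity. The nilradical is the maximal nilpotent ideal. A superderivation of degree $|d|\in\mathbb{Z}_2$ is a homogeneous endomorphism $d$ of degree $|d|$ with $d([x,y])=[d(x),y]+(-1)^{|d||x|}[x,d(y)]$; the superderivations of $\mathcal{L}$ are the elements of $Der(\mathcal{L})=Der(\mathcal{L})_0\oplus Der(\mathcal{L})_1$. Inner superderivations are those given by bracketing with a fixed element of $\mathcal{L}$ ($ad_x(y)=[y,x]$, with the usual super sign conventions). A torus of $\mathcal{L}$ is a commuting Lie algebra of diagonalizable even superderivations of $\mathcal{L}$; a maximal torus $\mathcal{T}_{max}$ is one not strictly contained in another torus (all maximal tori of a nilpotent Lie superalgebra have the same dimension). A nilpotent Lie superalgebra $\mathcal{N}$ is of maximal rank if $\dim\mathcal{T}_{max}=\dim(\mathcal{N}/[\mathcal{N},\mathcal{N}])$.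 A maximal solvable extension of $\mathcal{N}$ is a solvable Lie superalgebra $\mathcal{R}$ with nilradical $\mathcal{N}$ such that $\dim(\mathcal{R}/\mathcal{N})$ is maximal among solvable Lie superalgebras $\mathcal{R}'=\mathcal{R}'_0\oplus\mathcal{R}'_1$ with nilradical $\mathcal{N}$ satisfying $[\mathcal{R}',\mathcal{R}']\subseteq\mathcal{N}$ and $[\mathcal{R}'_1,\mathcal{R}'_1]\subseteq[\mathcal{R}'_0,\mathcal{R}'_0]$. *)

(* Defs.v *)
From HB Require Import structures.
From mathcomp Require Import all_boot all_order all_algebra.
From mathcomp Require Import reals complex.

Set Implicit Arguments.
Unset Strict Implicit.
Unset Printing Implicit Defensive.

Import GRing.Theory.
Local Open Scope ring_scope.

(* Parities are booleans: [false] is even, [true] is odd, [(+)] is addition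
   in Z/2 and [&&] is multiplication.  A [numFieldType] has characteristic 0,
   so these axioms need no supplement for characteristics 2 and 3. *)
Record lieSuperalgebra (F : numFieldType) := LieSuperalgebra {
  lsa_sort :> vectType F;
  lsa_gr : bool -> {vspace lsa_sort};
  lsa_br : lsa_sort -> lsa_sort -> lsa_sort;
  lsa_gr_full : (lsa_gr false + lsa_gr true)%VS = fullv;
  lsa_gr_direct : (lsa_gr false :&: lsa_gr true)%VS = 0%VS;
  lsa_br_linear_r : forall x, linear (lsa_br x);
  lsa_br_linear_l : forall y, linear (lsa_br^~ y);
  lsa_br_gr : forall i j x y, x \in lsa_gr i -> y \in lsa_gr j ->
    lsa_br x y \in lsa_gr (i (+) j);
  lsa_br_skew : forall i j x y, x \in lsa_gr i -> y \in lsa_gr j ->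
    lsa_br x y = - ((-1) ^+ (i && j) *: lsa_br y x);
  lsa_br_jacobi : forall i j x y z, x \in lsa_gr i -> y \in lsa_gr j ->
    lsa_br x (lsa_br y z) =
      lsa_br (lsa_br x y) z + (-1) ^+ (i && j) *: lsa_br y (lsa_br x z)
}.

Arguments lsa_gr {F} L i : rename.
Arguments lsa_br {F} {L} x y : rename.

(* The span of all brackets of an element of U with an element of W; see
   [lsa_brv_subP]. *)
Definition lsa_brv (F : numFieldType) (L : lieSuperalgebra F)
    (U W : {vspace L}) : {vspace L} :=
  <<[seq lsa_br u w | u <- vbasis U, w <- vbasis W]>>%VS.

Lemma lsa_brv_subP (F : numFieldType) (L : lieSuperalgebra F)
    (U W X : {vspace L}) :
  (lsa_brv U W <= X)%VS <->
  (forall u w, u \in U -> w \in W -> lsa_br u w \in X).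
Proof.
split=> [/span_subvP sUWX u w Uu Ww | sUWX]; last first.
  apply/span_subvP=> _ /allpairsP[[u w] /= [Uu Ww ->]].
  by apply: sUWX; rewrite vbasis_mem.
pose lin_r (x : L) :=
  GRing.isLinear.Build _ _ _ _ (lsa_br x) (lsa_br_linear_r x).
pose lin_l (y : L) :=
  GRing.isLinear.Build _ _ _ _ (fun x : L => lsa_br x y) (lsa_br_linear_l y).
pose fr x : {linear L -> L} := HB.pack (lsa_br x) (lin_r x).
pose fl y : {linear L -> L} := HB.pack (fun x : L => lsa_br x y) (lin_l y).
rewrite (coord_vbasis Uu) -[lsa_br _ w]/(fl w _) linear_sum /=.
apply: memv_suml => i _; rewrite -[lsa_br _ w]/(fl w _) linearZ /= memvZ //.
rewrite (coord_vbasis Ww) -[lsa_br _ _]/(fr _ _) linear_sum /=.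
apply: memv_suml => j _; rewrite -[lsa_br _ _]/(fr _ _) linearZ /= memvZ //.
by apply/sUWX/allpairs_f; apply/mem_nth; rewrite size_tuple.
Qed.

Definition lsa_ideal (F : numFieldType) (L : lieSuperalgebra F)
    (I : {vspace L}) : Prop :=
  I = (I :&: lsa_gr L false + I :&: lsa_gr L true)%VS /\
  (lsa_brv I fullv <= I)%VS.

(* Lower central series: U, [U, U], [[U, U], U], ... *)
Definition lsa_nilpotent (F : numFieldType) (L : lieSuperalgebra F)
    (U : {vspace L}) : Prop :=
  exists k, iter k (fun X => lsa_brv X U) U = 0%VS.

Definition lsa_solvable (F : numFieldType) (L : lieSuperalgebra F) : Prop :=
  exists k, iter k (fun X => lsa_brv X X) {: L}%VS = 0%VS.

Definition lsa_nilradical (F : numFieldType) (L : lieSuperalgebra F)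
    (I : {vspace L}) : Prop :=
  [/\ lsa_ideal I, lsa_nilpotent I &
      forall J : {vspace L}, lsa_ideal J -> lsa_nilpotent J -> (J <= I)%VS].

Definition superderivation_of_degree (F : numFieldType)
    (L : lieSuperalgebra F) (i : bool) (d : 'End(L)) : Prop :=
  (forall j x, x \in lsa_gr L j -> d x \in lsa_gr L (i (+) j)) /\
  (forall j x y, x \in lsa_gr L j ->
     d (lsa_br x y) = lsa_br (d x) y + (-1) ^+ (i && j) *: lsa_br x (d y)).

Definition superderivation (F : numFieldType) (L : lieSuperalgebra F)
    (d : 'End(L)) : Prop :=
  exists d0 d1 : 'End(L), [/\ superderivation_of_degree false d0,
    superderivation_of_degree true d1 & d = d0 + d1].

(* Leibniz rules with signs on the left are satisfied by y |-> [x, y], which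
   for homogeneous x and y is y |-> [y, x] up to the sign -(-1)^(|x||y|). *)
Definition inner_superderivation (F : numFieldType) (L : lieSuperalgebra F)
    (d : 'End(L)) : Prop :=
  exists x : L, forall y : L, d y = lsa_br x y.

Definition lsa_center_trivial (F : numFieldType) (L : lieSuperalgebra F) :
    Prop :=
  forall z : L, (forall y : L, lsa_br z y = 0) -> z = 0.

Definition diagonalizable_end (F : fieldType) (V : vectType F)
    (d : 'End(V)) : Prop :=
  exists2 e : seq V, basis_of fullv e &
    forall v, v \in e -> exists a : F, d v = a *: v.

Definition lsa_torus (F : numFieldType) (L : lieSuperalgebra F)
    (T : {vspace 'End(L)}) : Prop :=
  (forall d, d \in T ->
     superderivation_of_degree false d /\ diagonalizable_end d) /\
  (forall d d', d \in T -> d' \in T -> (d \o d' = d' \o d)%VF).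

Definition lsa_maximal_torus (F : numFieldType) (L : lieSuperalgebra F)
    (T : {vspace 'End(L)}) : Prop :=
  lsa_torus T /\
  forall T' : {vspace 'End(L)}, lsa_torus T' -> (T <= T')%VS -> T' = T.

Definition lsa_maximal_rank (F : numFieldType) (N : lieSuperalgebra F) :
    Prop :=
  exists2 T : {vspace 'End(N)}, lsa_maximal_torus T &
    \dim T = (\dim {: N} - \dim (lsa_brv {: N} {: N}))%N.

Definition lsa_embedding (F : numFieldType) (N L : lieSuperalgebra F)
    (f : 'Hom(N, L)) : Prop :=
  [/\ lker f = 0%VS,
      forall i x, x \in lsa_gr N i -> f x \in lsa_gr L i &
      forall x y, f (lsa_br x y) = lsa_br (f x) (f y)].

(* L, with N identified with its image under f, is solvable with
   nilradical N. *)
Definition solvable_extension (F : numFieldType) (N L : lieSuperalgebra F)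
    (f : 'Hom(N, L)) : Prop :=
  [/\ lsa_embedding f, lsa_solvable L & lsa_nilradical (limg f)].

Definition extension_conditions (F : numFieldType) (N L : lieSuperalgebra F)
    (f : 'Hom(N, L)) : Prop :=
  (lsa_brv {: L} {: L} <= limg f)%VS /\
  (lsa_brv (lsa_gr L true) (lsa_gr L true)
     <= lsa_brv (lsa_gr L false) (lsa_gr L false))%VS.

Definition extension_codim (F : numFieldType) (N L : lieSuperalgebra F)
    (f : 'Hom(N, L)) : nat := (\dim {: L} - \dim (limg f))%N.

Definition maximal_solvable_extension (F : numFieldType)
    (N L : lieSuperalgebra F) (f : 'Hom(N, L)) : Prop :=
  solvable_extension f /\
  forall (L' : lieSuperalgebra F) (f' : 'Hom(N, L')),
    solvable_extension f' -> extension_conditions f' ->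
    (extension_codim f' <= extension_codim f)%N.

(* Main.v *)
Require Import Defs.
From HB Require Import structures.
From mathcomp Require Import all_boot all_order all_algebra.
From mathcomp Require Import reals complex.
From mathcomp Require Import zify ring.

(* Let I be the nilradical of L, and n = dim I/[I,I].  A homogeneous x acting
   nilpotently on I/[I,I] generates, together with I, a nilpotent ideal, so it
   lies in I; hence L_1 <= I, since [[u,x],x] = [u,[x,x]]/2 for odd x, and
   L_0/(L_0 :&: I) acts on I/[I,I] by commuting matrices, none of them nilpotent
   except 0.  The semidirect product of N with a maximal torus satisfies the
   extension conditions, so dim L/I >= n by maximality.  A commuting space of
   n x n matrices of dimension >= n without nonzero nilpotents is conjugate to
   the space of all diagonal matrices.  So some even h acts as the identity on
   I/[I,I], hence with eigenvalue k on the k-th layer of the lower central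
   series of I; this splits L as H + I with H the centralizer of h, and H acts
   on the 1-eigenspace of h, which generates I, as all diagonal matrices.  The
   center is therefore trivial, and a superderivation can be corrected by inner
   ones until it kills h, then H, then the generators. *)

Set Implicit Arguments.
Unset Strict Implicit.
Unset Printing Implicit Defensive.

Import GRing.Theory Num.Theory.
Local Open Scope ring_scope.

Local Notation "[< x , y >]" := (lsa_br x y)
  (at level 0, format "[< x ,  y >]").

(** * Commuting matrices *)

(** The characteristic polynomial is ['X ^+ n.+1], so Cayley-Hamilton applies. *)
Lemma trig_mx_nilpotent (F : fieldType) n (A : 'M[F]_n.+1) :
  is_trig_mx A -> (forall i, A i i = 0) -> A ^+ n.+1 = 0.
Proof.
move=> Atrig A0; have := Cayley_Hamilton A; rewrite char_poly_trig //.
under eq_bigr do rewrite A0 subr0.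
by rewrite prodr_const card_ord rmorphXn /= horner_mx_X.
Qed.

(** The characteristic polynomial is a product of distinct linear factors, and the minimal
    polynomial divides it. *)
Lemma conj_trig_mx_diagonalizable (F : fieldType) n (P A : 'M[F]_n.+1) :
  P \in unitmx -> is_trig_mx (conjmx P A) ->
  injective (fun i => conjmx P A i i) ->
  exists2 Q, Q \in unitmx & exists2 d : 'rV_n.+1, injective (d 0) &
    Q *m A = diag_mx d *m Q.
Proof.
move=> Pu Atrig Ainj; set c := fun i => _ in Ainj.
pose cs := [seq c i | i <- enum 'I_n.+1].
have cs_uniq : uniq cs by rewrite map_inj_uniq // enum_uniq.
have [|Q Qu] := (diagonalizableP A).2.
  exists cs => //; rewrite big_map big_enum /= -char_poly_trig //.
  rewrite -(@mxminpoly_uconj _ _ P A Pu).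
  exact: mxminpoly_dvd_char.
case/similar_diagPex=> d QAd; exists Q => //; exists d; last exact/similarP.
(* Each [c i] is a root of the minimal polynomial, hence an entry of [d]; since there are [n.+1]
   distinct values [c i], counting leaves no repetition in [d]. *)
have cs_sub : {subset cs <= [seq d 0 i | i <- enum 'I_n.+1]}.
  move=> _ /mapP[i _ ->]; rewrite -mem_undup -root_prod_XsubC -mxminpoly_diag.
  rewrite -(similar_mxminpoly Qu QAd) -(@mxminpoly_uconj _ _ P A Pu).
  rewrite root_mxminpoly char_poly_trig // -(big_map c predT (fun x => 'X - x%:P)).
  by rewrite root_prod_XsubC map_f ?mem_index_enum.
have := leq_size_uniq cs_uniq cs_sub.
by rewrite !size_map leqnn => /(_ isT) /injectiveP.
Qed.

Lemma limg_full (F : fieldType) (aT rT : vectType F) (f : 'Hom(aT, rT))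
    (U : {vspace aT}) :
  (U :&: lker f = 0)%VS -> (\dim {: rT} <= \dim U)%N -> (f @: U)%VS = fullv.
Proof.
move=> Uf dimU; apply/eqP; rewrite eqEdim subvf /=.
by rewrite limg_dim_eq.
Qed.

Lemma mulmx_diag_comm (F : fieldType) n (d : 'rV[F]_n) (B : 'M[F]_n) :
  injective (d 0) -> diag_mx d *m B = B *m diag_mx d -> is_diag_mx B.
Proof.
move=> d_inj; rewrite mul_diag_mx mul_mx_diag => /matrixP dB.
apply/is_diag_mxP => i j ij; have := dB i j; rewrite !mxE mulrC => /eqP.
rewrite -subr_eq0 -mulrBr mulf_eq0 subr_eq0 => /orP[/eqP //|/eqP /d_inj eij].
by rewrite eij eqxx in ij.
Qed.

Lemma iter_mulmx (F : fieldType) m n (A : 'M[F]_n.+1) (v : 'M_(m, n.+1)) k :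
  iter k (mulmx^~ A) v = v *m A ^+ k.
Proof.
elim: k => [|k IHk] /=; first by rewrite expr0 mulmx1.
by rewrite IHk exprSr -mulmxA.
Qed.

Section CommutingMatrices.
Variables (C : numClosedFieldType) (n : nat) (S : {vspace 'M[C]_n.+1}).
Hypothesis S_comm : forall A B, A \in S -> B \in S -> A *m B = B *m A.
Hypothesis S_reduced :
  forall A, A \in S -> (exists k, A ^+ k = 0) -> A = 0.
Hypothesis dimS : (n.+1 <= \dim S)%N.

Let diag_of (P A : 'M[C]_n.+1) : 'rV[C]_n.+1 := \row_i (P *m A *m invmx P) i i.

Let diag_of_linear P : linear (diag_of P).
Proof.
move=> a A B; apply/rowP=> i.
have e : P *m (a *: A + B) *m invmx P =
    a *: (P *m A *m invmx P) + P *m B *m invmx P.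
  by rewrite mulmxDr mulmxDl -scalemxAr -scalemxAl.
by rewrite [LHS]mxE e !mxE.
Qed.

HB.instance Definition _ P :=
  GRing.isLinear.Build _ _ _ _ (diag_of P) (diag_of_linear P).

(** A matrix of [S] with zero diagonal after conjugation is nilpotent, hence 0. So taking diagonals
    is injective on [S], and [dimS] makes it onto. *)
Let diag_of_onto P : P \in unitmx ->
  (forall A, A \in S -> is_trig_mx (conjmx P A)) ->
  forall d, exists2 A, A \in S & diag_of P A = d.
Proof.
move=> Pu Ptrig d.
have/memv_imgP[A SA ->] : d \in (linfun (diag_of P) @: S)%VS; last first.
  by exists A; rewrite // lfunE.
rewrite limg_full ?memvf //; last first.
  by rewrite dimvf dim_matrix; apply: leq_trans dimS; rewrite mul1r.
apply/eqP; rewrite -subv0; apply/subvP=> A /memv_capP[SA].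
rewrite memv_ker lfunE /= memv0 => /eqP/rowP A0.
apply/eqP/S_reduced => //; exists n.+1.
have PA := trig_mx_nilpotent (Ptrig A SA); rewrite conjumx // in PA.
have PX k : (P *m A *m invmx P) ^+ k = P *m A ^+ k *m invmx P.
  elim: k => [|k IHk]; first by rewrite !expr0 mulmx1 mulmxV.
  by rewrite !exprSr IHk -!mulmxE !mulmxA mulmxKV.
have: P *m A ^+ n.+1 *m invmx P = 0.
  by rewrite -PX; apply: PA => i; have := A0 i; rewrite !mxE.
move/(congr1 (fun B => invmx P *m B *m P)).
by rewrite !mulmxA mulVmx // mul1mx mulmxKV // mulmx0 mul0mx.
Qed.

(** Triangularize [S] simultaneously, pick in it a matrix with distinct eigenvalues and diagonalize
    that one: whatever commutes with it becomes diagonal too. *)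
Lemma commuting_diagonalizable_succ : exists2 P, P \in unitmx &
  (forall A, A \in S -> exists d, P *m A = diag_mx d *m P) /\
  (forall d, exists2 A, A \in S & P *m A = diag_mx d *m P).
Proof.
have [|P /unitarymx_unit Pu /allP/= Ptrig] := @cotrigonalization C _ (vbasis S).
  by move=> A B /vbasis_mem SA /vbasis_mem SB; apply: S_comm.
have {}Ptrig A : A \in S -> is_trig_mx (conjmx P A).
  move=> /coord_vbasis ->; rewrite conjumx // mulmx_sumr mulmx_suml.
  apply/is_trig_mxP => i j ij; rewrite summxE big1 // => k _.
  rewrite -scalemxAr -scalemxAl mxE -conjumx //.
  have /Ptrig/is_trig_mxP-> // : (vbasis S)`_k \in vbasis S.
    by apply: mem_nth; rewrite size_tuple.
  by rewrite mulr0.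
(* The eigenvalues 0, ..., n are distinct in characteristic 0. *)
have [A SA dA] := diag_of_onto Pu Ptrig (\row_i (i : nat)%:R).
have [|Q Qu [d d_inj QA]] := conj_trig_mx_diagonalizable Pu (Ptrig A SA).
  have PA k : conjmx P A k k = (k : nat)%:R.
    by rewrite conjumx //; transitivity (diag_of P A 0 k);
      by [rewrite [RHS]mxE | rewrite dA mxE].
  by move=> i j; rewrite /= !PA => /eqP; rewrite eqr_nat => /eqP/val_inj.
have Qdiag B : B \in S -> is_diag_mx (conjmx Q B).
  move=> SB; apply: (mulmx_diag_comm d_inj); rewrite conjumx //.
  have -> : diag_mx d = Q *m A *m invmx Q by rewrite QA mulmxK.
  by rewrite !mulmxA !mulmxKV // -(mulmxA Q A) (S_comm SA SB) mulmxA.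
have Q_eq B : B \in S -> Q *m B = diag_mx (diag_of Q B) *m Q.
  move=> /Qdiag /diag_mxP[e]; rewrite conjumx // => QBe.
  suff -> : diag_of Q B = e by rewrite -QBe mulmxKV.
  by apply/rowP=> i; rewrite [LHS]mxE QBe mxE eqxx.
exists Q => //; split=> [B SB|e]; first by exists (diag_of Q B); apply: Q_eq.
(* Diagonal matrices are triangular, so surjectivity holds for [Q] as it did for [P]. *)
have [|B SB <-] := diag_of_onto Qu _ e; last by exists B; rewrite // Q_eq.
by move=> B /Qdiag /is_diag_mx_is_trig.
Qed.
End CommutingMatrices.

(** Nilpotency is expressed by iteration on row vectors because powers of matrices exist only in
    size [n.+1]; size 0 is treated apart. *)
Lemma commuting_diagonalizable (C : numClosedFieldType) n
    (S : {vspace 'M[C]_n}) :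
  (forall A B, A \in S -> B \in S -> A *m B = B *m A) ->
  (forall A, A \in S ->
     (exists k, forall v : 'rV_n, iter k (mulmx^~ A) v = 0) -> A = 0) ->
  (n <= \dim S)%N ->
  exists2 P, P \in unitmx &
    (forall A, A \in S -> exists d, P *m A = diag_mx d *m P) /\
    (forall d, exists2 A, A \in S & P *m A = diag_mx d *m P).
Proof.
case: n S => [|n] S S_comm S_reduced dimS.
  exists 1%:M; rewrite ?unitmx1 //.
  split=> [A SA|d]; first by exists 0; apply/matrixP => -[].
  by exists 0; [apply: mem0v | apply/matrixP => -[]].
apply: commuting_diagonalizable_succ => // A SA [k Ak].
by apply: S_reduced => //; exists k => v; rewrite iter_mulmx Ak mulmx0.
Qed.

(** * Brackets, gradings and lower central series *)

Section Bracket.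
Variables (F : numFieldType) (L : lieSuperalgebra F).
Implicit Types (x y z u v w : L) (U V W X : {vspace L}) (i j k : bool).

Definition radj (y : L) : L -> L := fun x => [< x, y >].

HB.instance Definition _ x :=
  GRing.isLinear.Build _ _ _ _ (@lsa_br F L x) (lsa_br_linear_r x).
HB.instance Definition _ y :=
  GRing.isLinear.Build _ _ _ _ (radj y) (lsa_br_linear_l y).

Definition lsa_ad x : 'End(L) := linfun (@lsa_br F L x).
Definition lsa_rad y : 'End(L) := linfun (radj y).

Lemma lsa_adE x y : lsa_ad x y = [< x, y >]. Proof. exact: lfunE. Qed.
Lemma lsa_radE x y : lsa_rad y x = [< x, y >]. Proof. exact: lfunE. Qed.

Lemma brDl x y z : [< x + y, z >] = [< x, z >] + [< y, z >].
Proof. by rewrite -!lsa_radE linearD. Qed.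
Lemma brDr x y z : [< z, x + y >] = [< z, x >] + [< z, y >].
Proof. by rewrite -!lsa_adE linearD. Qed.
Lemma brBl x y z : [< x - y, z >] = [< x, z >] - [< y, z >].
Proof. by rewrite -!lsa_radE linearB. Qed.
Lemma brBr x y z : [< z, x - y >] = [< z, x >] - [< z, y >].
Proof. by rewrite -!lsa_adE linearB. Qed.
Lemma brZl a x z : [< a *: x, z >] = a *: [< x, z >].
Proof. by rewrite -!lsa_radE linearZ. Qed.
Lemma brZr a x z : [< z, a *: x >] = a *: [< z, x >].
Proof. by rewrite -!lsa_adE linearZ. Qed.
Lemma brNl x z : [< - x, z >] = - [< x, z >].
Proof. by rewrite -!lsa_radE linearN. Qed.
Lemma brNr x z : [< z, - x >] = - [< z, x >].
Proof. by rewrite -!lsa_adE linearN. Qed.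
Lemma br0l z : [< 0, z >] = 0.
Proof. by rewrite -!lsa_radE linear0. Qed.
Lemma br0r z : [< z, 0 >] = 0.
Proof. by rewrite -!lsa_adE linear0. Qed.

Lemma lsa_ad_linear : linear lsa_ad.
Proof.
move=> a x y; apply/lfunP => z.
by rewrite add_lfunE scale_lfunE !lsa_adE brDl brZl.
Qed.
HB.instance Definition _ :=
  GRing.isLinear.Build _ _ _ _ lsa_ad lsa_ad_linear.

Definition parity_part i : 'End(L) := daddv_pi (lsa_gr L i) (lsa_gr L (~~ i)).

Lemma lsa_gr_cap i : (lsa_gr L i :&: lsa_gr L (~~ i) = 0)%VS.
Proof. by case: i; rewrite ?lsa_gr_direct // capvC lsa_gr_direct. Qed.

Lemma lsa_gr_add i : (lsa_gr L i + lsa_gr L (~~ i) = fullv)%VS.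
Proof. by case: i; rewrite ?lsa_gr_full // addvC lsa_gr_full. Qed.

Lemma parity_part_mem i x : parity_part i x \in lsa_gr L i.
Proof. exact: memv_pi. Qed.

Lemma parity_partC i x : parity_part i x + parity_part (~~ i) x = x.
Proof.
by rewrite /parity_part negbK daddv_pi_add ?lsa_gr_cap // lsa_gr_add memvf.
Qed.

Lemma parity_part_id i x : x \in lsa_gr L i -> parity_part i x = x.
Proof. by apply: daddv_pi_id; rewrite lsa_gr_cap. Qed.

Lemma parity_part_eq0 i x : x \in lsa_gr L (~~ i) -> parity_part i x = 0.
Proof.
move=> gr_x; apply: (addIr (parity_part (~~ i) x)).
by rewrite parity_partC add0r parity_part_id.
Qed.

Definition lsa_graded U : Prop := forall i x, x \in U -> parity_part i x \in U.

Lemma lsa_gradedP U :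
  U = (U :&: lsa_gr L false + U :&: lsa_gr L true)%VS <-> lsa_graded U.
Proof.
split=> [Ugr i x | Ugr].
  rewrite {1}Ugr => /memv_addP[x0 /memv_capP[U0 gr0]].
  case=> x1 /memv_capP[U1 gr1] ->; rewrite linearD /=.
  case: i; first by rewrite parity_part_eq0 // parity_part_id // add0r.
  by rewrite parity_part_id // (@parity_part_eq0 false) // addr0.
apply/eqP; rewrite eqEsubv subv_add !capvSl !andbT; apply/subvP=> x Ux.
rewrite -(parity_partC false x).
by rewrite memv_add // memv_cap Ugr // parity_part_mem.
Qed.

Lemma lsa_graded_full : lsa_graded fullv.
Proof. by move=> i x _; apply: memvf. Qed.

Lemma brv_mem U W u w : u \in U -> w \in W -> [< u, w >] \in lsa_brv U W.
Proof. exact: (lsa_brv_subP U W _).1. Qed.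

Lemma brv_mono U V W X :
  (U <= V)%VS -> (W <= X)%VS -> (lsa_brv U W <= lsa_brv V X)%VS.
Proof.
move=> /subvP sUV /subvP sWX; apply/lsa_brv_subP => u w Uu Ww.
by rewrite brv_mem ?sUV ?sWX.
Qed.

(** Skew-symmetry and Jacobi are available for homogeneous elements only; for graded subspaces it is
    enough to test those. *)
Lemma brv_sub_homog U W X : lsa_graded U -> lsa_graded W ->
  (forall i j u w, u \in U -> u \in lsa_gr L i -> w \in W ->
     w \in lsa_gr L j -> [< u, w >] \in X) ->
  (lsa_brv U W <= X)%VS.
Proof.
move=> Ugr Wgr UWX; apply/lsa_brv_subP=> u w Uu Ww.
rewrite -(parity_partC true u) -(parity_partC true w) !brDl !brDr.
have homog i j : [< parity_part i u, parity_part j w >] \in X.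
  by apply: (UWX i j); rewrite ?Ugr ?Wgr ?parity_part_mem.
by rewrite !memvD.
Qed.

Lemma lsa_graded_brv U W :
  lsa_graded U -> lsa_graded W -> lsa_graded (lsa_brv U W).
Proof.
move=> Ugr Wgr k x; suff/subvP sUW : (lsa_brv U W <=
    parity_part k @^-1: lsa_brv U W)%VS by move/sUW; rewrite -memv_preim.
apply: brv_sub_homog => // i j u w Uu gru Ww grw; rewrite -memv_preim.
have gruw := lsa_br_gr gru grw.
have [eq_k|neq_k] := eqVneq k (i (+) j).
  by rewrite parity_part_id ?eq_k // brv_mem.
rewrite parity_part_eq0 ?mem0v //; congr (_ \in lsa_gr L _): gruw.
by case: k (i (+) j) neq_k => [] [].
Qed.

Lemma br_memC i j u w X : u \in lsa_gr L i -> w \in lsa_gr L j ->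
  [< u, w >] \in X -> [< w, u >] \in X.
Proof.
by move=> gru grw Xuw; rewrite (lsa_br_skew grw gru) memvN memvZ.
Qed.

Lemma brvC U W : lsa_graded U -> lsa_graded W -> lsa_brv U W = lsa_brv W U.
Proof.
move=> Ugr Wgr; apply/eqP; rewrite eqEsubv.
by apply/andP; split; apply: brv_sub_homog => // i j u w Uu gru Ww grw;
  apply: br_memC grw gru _; rewrite brv_mem.
Qed.

(** The Leibniz rule of an even superderivation carries no sign, so it can be stated for all
    elements. *)
Definition even_derivation (D : 'End(L)) : Prop :=
  forall u w, D [< u, w >] = [< D u, w >] + [< u, D w >].

Lemma superderivation_even D :
  superderivation_of_degree false D -> even_derivation D.
Proof.
case=> _ Dbr u w; rewrite -(parity_partC true u) !brDl !linearD /= !brDl.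
rewrite !(Dbr _ _ _ (parity_part_mem _ _)) !expr0 !scale1r.
by rewrite addrACA.
Qed.

Lemma lsa_ad_even x : x \in lsa_gr L false -> even_derivation (lsa_ad x).
Proof.
move=> grx u w; rewrite !lsa_adE -(parity_partC true u) !brDl !brDr !brDl.
rewrite !(lsa_br_jacobi _ grx (parity_part_mem _ _)) !expr0 !scale1r.
by rewrite addrACA.
Qed.

Lemma br_even_odd x y : x \in lsa_gr L false -> [< y, x >] = - [< x, y >].
Proof.
move=> grx; rewrite -(parity_partC true y) brDl brDr.
by rewrite !(lsa_br_skew (parity_part_mem _ _) grx) !andbF !expr0 !scale1r opprD.
Qed.

Lemma lsa_rad_even x : x \in lsa_gr L false -> even_derivation (lsa_rad x).
Proof.
move=> grx u w; rewrite !lsa_radE !(br_even_odd _ grx) brNl brNr.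
by rewrite -lsa_adE lsa_ad_even // opprD !lsa_adE.
Qed.

(** For odd [x] the two terms of the Jacobi identity for [u], [x], [x] agree instead of
    cancelling. *)
Lemma lsa_rad_odd x u : x \in lsa_gr L true ->
  [< [< u, x >], x >] = 2^-1 *: [< u, [< x, x >] >].
Proof.
move=> grx; suff -> : [< u, [< x, x >] >] = 2 *: [< [< u, x >], x >].
  by rewrite scalerA mulVf ?scale1r // pnatr_eq0.
rewrite -(parity_partC true u) !brDl scalerDr.
have homog i : [< parity_part i u, [< x, x >] >] =
    2 *: [< [< parity_part i u, x >], x >].
  have gru := parity_part_mem i u.
  rewrite (lsa_br_jacobi x gru grx) (lsa_br_skew grx (lsa_br_gr gru grx)).
  by case: i {gru}; rewrite /= ?expr1 ?expr0 ?scale1r ?scaleN1r ?opprK scaler_nat.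
by rewrite !homog.
Qed.

End Bracket.
Arguments parity_part {F L} i.

(** Rewrites a condition on iterates as membership in a subspace, which can then be tested on
    generating brackets. *)
Lemma memv_iter_preim (K : fieldType) (V : vectType K) (D : 'End(V)) r
    (X : {vspace V}) v :
  (iter r D v \in X) = (v \in iter r (fun Y => D @^-1: Y)%VS X).
Proof. by elim: r v => [|r IHr] v //; rewrite iterSr IHr -memv_preim. Qed.

Lemma limg_stable (K : fieldType) (V : vectType K) (D : 'End(V))
    (W : {vspace V}) :
  (forall v, v \in W -> D v \in W) -> (forall v, v \in W -> D v = 0 -> v = 0) ->
  forall v, v \in W -> exists2 w, w \in W & D w = v.
Proof.
move=> DW D_inj v; suff DWE : (D @: W)%VS = W.
  by rewrite -{1}DWE => /memv_imgP[w Ww ->]; exists w.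
apply/eqP; rewrite eqEdim limg_dim_eq ?leqnn ?andbT.
  by apply/subvP => _ /memv_imgP[w Ww ->]; apply: DW.
apply/eqP; rewrite -subv0; apply/subvP => w /memv_capP[Ww].
by rewrite memv_ker memv0 => /eqP/(D_inj _ Ww) ->.
Qed.

Section LowerCentralSeries.
Variables (F : numFieldType) (L : lieSuperalgebra F) (I : {vspace L}).
Hypothesis I_ideal : lsa_ideal I.
Implicit Types (x y z u v w : L) (D : 'End(L)).

(* [lcs 0] is [I] itself, so [lcs k] is usually written I^(k+1). *)
Definition lcs k : {vspace L} := iter k (fun X => lsa_brv X I) I.
Arguments lcs k : simpl never.

Let I_graded : lsa_graded I. Proof. exact/lsa_gradedP/(I_ideal.1). Qed.

Lemma ideal_brl x y : x \in I -> [< x, y >] \in I.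
Proof.
move=> Ix; apply: (subvP I_ideal.2); apply: brv_mem => //; exact: memvf.
Qed.

Lemma ideal_brr x y : x \in I -> [< y, x >] \in I.
Proof.
move=> Ix; apply: (subvP I_ideal.2); rewrite brvC ?brv_mem ?memvf //.
exact: lsa_graded_full.
Qed.

Lemma lcs_graded k : lsa_graded (lcs k).
Proof. by elim: k => [|k IHk] //=; apply: lsa_graded_brv. Qed.

Lemma lcs_br k x y : x \in lcs k -> y \in I -> [< x, y >] \in lcs k.+1.
Proof. exact: brv_mem. Qed.

Lemma lcs_brC k x y : x \in I -> y \in lcs k -> [< x, y >] \in lcs k.+1.
Proof.
by move=> Ix Cy; rewrite /lcs /= brvC ?brv_mem //; apply: lcs_graded.
Qed.

(** By Jacobi, [[[u, w], y]] is a combination of [[u, [w, y]]] and [[w, [u, y]]]; the ideal property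
    handles the first and induction the second. *)
Lemma lcs_brl k x y : x \in lcs k -> [< x, y >] \in lcs k.
Proof.
elim: k x y => [|k IHk] x y; first exact: ideal_brl.
rewrite -lsa_radE memv_preim; apply: subvP.
apply: brv_sub_homog => // [|i j u w Cu gru Iw grw]; first exact: lcs_graded.
rewrite -memv_preim lsa_radE.
have /eqP := lsa_br_jacobi y gru grw; rewrite -subr_eq => /eqP <-.
apply: memvB; first by apply: lcs_br => //; apply: ideal_brl.
by apply/memvZ/lcs_brC/IHk.
Qed.

Lemma lcs_brr k x y : x \in lcs k -> [< y, x >] \in lcs k.
Proof.
have lcs_full : (lsa_brv (lcs k) fullv <= lcs k)%VS.
  by apply/lsa_brv_subP => u w Cu _; apply: lcs_brl.
move=> Cx; apply: (subvP lcs_full).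
by rewrite brvC ?brv_mem ?memvf //; [apply: lcs_graded | apply: lsa_graded_full].
Qed.

Lemma lcs_subS k : (lcs k.+1 <= lcs k)%VS.
Proof. by apply/lsa_brv_subP=> u w Cu _; apply: lcs_brl. Qed.

Lemma lcs_sub k : (lcs k <= I)%VS.
Proof. by elim: k => [|k] //; apply: subv_trans; apply: lcs_subS. Qed.

(** This is the case b = 2 of [I^a, I^b] <= I^(a+b). It gains the additional layer needed when one
    factor is known only modulo [I, I]. *)
Lemma lcs_br1 k x y : x \in lcs k -> y \in lcs 1 -> [< x, y >] \in lcs k.+2.
Proof.
move=> Cx; rewrite -lsa_adE memv_preim; apply: subvP.
apply/lsa_brv_subP => u w Iu Iw; rewrite -memv_preim lsa_adE.
rewrite -(parity_partC true u) -(parity_partC true x) !brDl !brDr.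
have homog i j : [< parity_part i x, [< parity_part j u, w >] >] \in lcs k.+2.
  rewrite (lsa_br_jacobi w (parity_part_mem i x) (parity_part_mem j u)).
  have Cxi : parity_part i x \in lcs k by apply: lcs_graded.
  have Iuj : parity_part j u \in I by apply: I_graded.
  rewrite memvD ?memvZ //; first by apply: lcs_br => //; apply: lcs_br.
  by apply: lcs_brC => //; apply: lcs_br.
by rewrite !memvD.
Qed.

(** * Derivations acting on the lower central series *)

Section Derivation.
Variable D : 'End(L).
Hypothesis D_der : even_derivation D.

Lemma der_lcs k x : (forall x, x \in I -> D x \in I) ->
  x \in lcs k -> D x \in lcs k.
Proof.
move=> DI; elim: k x => [|k IHk] x; first exact: DI.
rewrite [D x \in _]memv_preim; apply: subvP.
apply/lsa_brv_subP => u w Cu Iw; rewrite -memv_preim D_der.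
by rewrite memvD //; apply: lcs_br => //; [apply: IHk | apply: DI].
Qed.

(** Modulo [lcs k.+1], layer [k] consists of sums of brackets of [k.+1] factors, and [D] contributes
    1 for each factor. *)
Lemma der_shift_lcs k x : (forall x, x \in I -> D x - x \in lcs 1) ->
  x \in lcs k -> D x - k.+1%:R *: x \in lcs k.+1.
Proof.
move=> DI; elim: k x => [|k IHk] x; first by rewrite scale1r; apply: DI.
have ->: D x - k.+2%:R *: x = (D - k.+2%:R *: \1%VF) x.
  by rewrite add_lfunE opp_lfunE scale_lfunE id_lfunE.
rewrite memv_preim; apply: subvP; apply/lsa_brv_subP => u w Cu Iw.
rewrite -memv_preim add_lfunE opp_lfunE scale_lfunE id_lfunE D_der.
have -> : [< D u, w >] + [< u, D w >] - k.+2%:R *: [< u, w >] =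
    [< D u - k.+1%:R *: u, w >] + [< u, D w - w >].
  rewrite brBl brBr brZl -[in LHS](addn1 k.+1) natrD scalerDl scale1r opprD.
  by rewrite addrACA.
by rewrite memvD //; [apply/lcs_br/Iw/IHk | apply/lcs_br1/DI].
Qed.

(** In layer [k], [D] is the scalar [k.+1] modulo the next layer. An eigenvector for another
    eigenvalue therefore sinks one layer at a time until nilpotency makes it 0. *)
Lemma der_shift_eq0 k0 a x : lsa_nilpotent I ->
  (forall x, x \in I -> D x - x \in lcs 1) ->
  (forall k, (k0 <= k)%N -> k.+1%:R != a) ->
  x \in lcs k0 -> D x = a *: x -> x = 0.
Proof.
case=> n In0 DI ka Cx Dx.
have {}Cx m : x \in lcs (m + k0).
  elim: m => [|m IHm] //; have := der_shift_lcs DI IHm.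
  rewrite Dx -scalerBl => /(memvZ (a - (m + k0).+1%:R)^-1).
  by rewrite scalerA mulVf ?scale1r // subr_eq0 eq_sym ka ?leq_addl.
have: x \in lcs n by apply: subvP (Cx n); elim: (k0) => [|k IHk];
  rewrite ?addn0 // addnS (subv_trans (lcs_subS _)).
by rewrite /lcs In0 memv0 => /eqP.
Qed.

Lemma der_nilpotent_lcs m k : (forall x, x \in I -> D x \in I) ->
  (forall x, x \in I -> iter m D x \in lcs 1) ->
  exists M, forall x, x \in lcs k -> iter M D x \in lcs k.+1.
Proof.
move=> DI Dm; have DiI r x : x \in I -> iter r D x \in I.
  by elim: r => //= r IHr /IHr; apply: DI.
have DiC j r x : x \in lcs j -> iter r D x \in lcs j.
  by elim: r => //= r IHr /IHr; apply: der_lcs.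
elim: k => [|k [M DM]]; first by exists m.
have DiM r u : u \in lcs k -> (M <= r)%N -> iter r D u \in lcs k.+1.
  by move=> Cu /subnK <-; rewrite iterD DiC // DM.
have Dim r u : u \in I -> (m <= r)%N -> iter r D u \in lcs 1.
  by move=> Iu /subnK <-; rewrite iterD DiC // Dm.
(* Leibniz: in a product of total D-degree at least M + m, one factor has
   moved one step down the series. *)
have iter_add r x y : iter r D (x + y) = iter r D x + iter r D y.
  by elim: r => //= r ->; rewrite linearD.
have key r a b u w : u \in lcs k -> w \in I -> (M + m <= r + a + b)%N ->
    iter r D [< iter a D u, iter b D w >] \in lcs k.+2.
  elim: r a b => [|r IHr] a b Cu Iw.
    rewrite add0n => Mab; have [Ma|aM] := leqP M a.
      by rewrite lcs_br ?DiM ?DiI.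
    by apply: lcs_br1; [apply: DiC | apply: Dim => //; move: Mab aM; lia].
  rewrite iterSr D_der iter_add -!iterS => Mab.
  by rewrite memvD ?IHr //; move: Mab; lia.
exists (M + m)%N => x; rewrite memv_iter_preim; apply: subvP.
apply/lsa_brv_subP => u w Cu Iw; rewrite -memv_iter_preim.
by apply: (key _ 0 0); rewrite ?addn0.
Qed.

Lemma der_nilpotent m : lsa_nilpotent I ->
  (forall x, x \in I -> D x \in I) ->
  (forall x, x \in I -> iter m D x \in lcs 1) ->
  exists M, forall x, x \in I -> iter M D x = 0.
Proof.
case=> n In0 DI Dm.
suff [M DM]: exists M, forall x, x \in I -> iter M D x \in lcs n.
  by exists M => x /DM; rewrite /lcs In0 memv0 => /eqP.
elim: n {In0} => [|k [M DM]]; first by exists 0.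
have [M' DM'] := der_nilpotent_lcs k DI Dm.
by exists (M' + M)%N => x Ix; rewrite iterD DM' ?DM.
Qed.

Section Shift.
Hypothesis I_nilp : lsa_nilpotent I.
Hypothesis DI : forall x, x \in I -> D x - x \in lcs 1.

Lemma shift_stable k x : x \in lcs k -> D x \in lcs k.
Proof.
apply: der_lcs => y Iy; rewrite -(subrK y (D y)) memvD //.
by rewrite (subvP (lcs_sub 1)) ?DI.
Qed.

(** The only possible eigenvalues on [I] are 1, 2, 3, ... *)
Lemma shift_inj x : x \in I -> D x = 0 -> x = 0.
Proof.
move=> Ix Dx; apply: (@der_shift_eq0 0 0 x) => //; last by rewrite scale0r.
by move=> k _; rewrite pnatr_eq0.
Qed.

Lemma shift_onto x : x \in I -> exists2 y, y \in I & D y = x.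
Proof.
by apply: limg_stable => y; [apply: (@shift_stable 0) | apply: shift_inj].
Qed.

(** On [lcs I 1] the possible eigenvalues start at 2. *)
Lemma shift_fix_eq0 x : x \in lcs 1 -> D x = x -> x = 0.
Proof.
move=> Ux Dx; apply: (@der_shift_eq0 1 1 x) => //; last by rewrite scale1r.
by move=> k k_gt0; rewrite pnatr_eq1 eqSS -lt0n.
Qed.

(** [D - 1] maps [I] into [lcs I 1] and is bijective on [lcs I 1], so every class modulo [I, I]
    contains a vector fixed by [D]. *)
Lemma shift_fix_part x : x \in I ->
  exists2 y, y \in lcs 1 & D (x - y) = x - y.
Proof.
move=> Ix.
have D1E y : (D - \1%VF) y = D y - y.
  by rewrite add_lfunE opp_lfunE id_lfunE.
have [|y Uy|y Uy Dy] := @limg_stable _ _ (D - \1%VF) (lcs 1) _ _ _ (DI Ix).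
- by move=> y Uy; rewrite D1E memvB ?shift_stable.
- by rewrite D1E => /eqP; rewrite subr_eq0 => /eqP; apply: shift_fix_eq0.
exists y; rewrite // linearB /=.
have -> : D x = D y - y + x by rewrite -D1E Dy subrK.
by rewrite addrAC (addrAC (D y)) subrr add0r addrC.
Qed.
End Shift.

End Derivation.
End LowerCentralSeries.
Arguments lcs {F L} I k : simpl never.

(** * The nilradical and its abelianization *)

Section Nilradical.
Variables (F : numFieldType) (L : lieSuperalgebra F) (I : {vspace L}).
Hypothesis I_nilrad : lsa_nilradical I.
Hypothesis LL_I : (lsa_brv {: L} {: L} <= I)%VS.
Implicit Types (x y u : L).

Let I_ideal : lsa_ideal I. Proof. by case: I_nilrad. Qed.

Lemma br_nilradical x y : [< x, y >] \in I.
Proof. by apply: (subvP LL_I); rewrite brv_mem ?memvf. Qed.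

(** The space [I + <[x]>] is graded since [x] is homogeneous, and an ideal since it contains [L, L];
    it remains to see that it is nilpotent. *)
Lemma nilradical_mem i x : x \in lsa_gr L i ->
  (forall k, exists M, forall y, y \in lcs I k ->
     iter M (lsa_rad x) y \in lcs I k.+1) ->
  x \in I.
Proof.
move=> grx nil_x; have [_ [n In0] Imax] := I_nilrad.
set J := (I + <[x]>)%VS; have IJ : (I <= J)%VS by apply: addvSl.
suff /subvP : (J <= I)%VS.
  by apply; rewrite -[x]add0r memv_add ?mem0v ?memv_line.
have Jideal : lsa_ideal J.
  split; last by apply: subv_trans IJ; apply: subv_trans LL_I;
    rewrite brv_mono ?subvf.
  apply/lsa_gradedP => j _ /memv_addP[y Iy [_ /vlineP[a ->] ->]].
  rewrite linearD linearZ memv_add //=.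
    by apply: (lsa_gradedP I).1 => //; case: I_ideal.
  apply: memvZ; have [-> | ji] := eqVneq j i.
    by rewrite parity_part_id ?memv_line.
  rewrite parity_part_eq0 ?mem0v //; congr (_ \in lsa_gr L _): grx.
  by case: i j ji => [] [].
apply: Imax => //; pose Js r := iter r (fun X => lsa_brv X J) J.
(* The lower central series of [J] sinks below every layer of [I], in particular below layer [n],
   which is 0. *)
suff [r Jr]: exists r, (Js r <= lcs I n)%VS.
  by exists r; apply/eqP; rewrite -subv0; move: Jr; rewrite /lcs In0.
elim: n {In0} => [|k [r Jr]].
  by exists 1; apply: subv_trans LL_I; rewrite brv_mono ?subvf.
have [M xM] := nil_x k; exists (M + r)%N.
(* Starting from layer [k], bracketing with [J = I + <[x]>] either applies [lsa_rad x] once more or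
   drops into layer [k.+1]; after [M] steps both alternatives lie there. *)
pose Bs j := iter j (fun X => lsa_rad x @: X)%VS (lcs I k).
have Bs_sub j : (Bs j <= lcs I k)%VS.
  elim: j => [|j IHj] //=; apply/subvP => _ /memv_imgP[y By ->].
  by rewrite lsa_radE lcs_brl // (subvP IHj).
have BsP j y : y \in Bs j -> exists2 z, z \in lcs I k & y = iter j (lsa_rad x) z.
  elim: j y => [|j IHj] y; first by exists y.
  by move=> /memv_imgP[_ /IHj[z Cz ->] ->]; exists z.
have BsM : (Bs M <= lcs I k.+1)%VS.
  by apply/subvP => _ /BsP[z Cz ->]; apply: xM.
suff: (Js (M + r)%N <= Bs M + lcs I k.+1)%VS.
  by move/subv_trans; apply; rewrite subv_add BsM subvv.
elim: M {xM BsM} => [|m IHm].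
  by rewrite add0n (subv_trans Jr) // addvSl.
rewrite addSn; apply/lsa_brv_subP => u w /(subvP IHm).
move=> /memv_addP[b Bb [c Cc ->]] /memv_addP[y Iy [_ /vlineP[a ->] ->]].
rewrite !brDl !brDr !brZr -!lsa_radE; apply: memvD; last first.
  apply: (subvP (addvSr _ _)); apply: memvD; last apply: memvZ.
    by rewrite lsa_radE lcs_brl.
  by rewrite lsa_radE lcs_brl.
rewrite addrC memv_add //; first by rewrite memvZ // memv_img.
by rewrite lsa_radE lcs_br // (subvP (Bs_sub m)).
Qed.

Lemma odd_sub_nilradical : (lsa_gr L true <= I)%VS.
Proof.
apply/subvP => x grx; apply: (nilradical_mem grx) => k; exists 2 => y Cy.
rewrite /= !lsa_radE lsa_rad_odd //; apply/memvZ/lcs_br => //.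
exact: br_nilradical.
Qed.

(** The Leibniz rule carries nilpotency on I/[I, I] over to every layer; left and right brackets by
    an even element differ only by a sign. *)
Lemma even_nilradical_mem x m : x \in lsa_gr L false ->
  (forall y, y \in I -> iter m (lsa_ad x) y \in lcs I 1) -> x \in I.
Proof.
move=> grx nil_x; apply: (nilradical_mem grx) => k.
apply: (@der_nilpotent_lcs _ _ _ I_ideal _ (lsa_rad_even grx) m).
  by move=> y Iy; rewrite lsa_radE ideal_brl.
move=> y Iy; have -> : iter m (lsa_rad x) y = (-1) ^+ m *: iter m (lsa_ad x) y.
  elim: m {nil_x} => [|m IHm] /=; first by rewrite scale1r.
  rewrite IHm linearZ /= lsa_radE (br_even_odd _ grx) -lsa_adE exprS mulN1r.
  by rewrite scalerN scaleNr.
by rewrite memvZ ?nil_x.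
Qed.

End Nilradical.

(** Here [q] plays the quotient map from [W] to [W/U] and [s] a linear section of it, both obtained
    from a basis of a complement of [U] in [W]. *)
Lemma quotient_coordinates (K : fieldType) (V : vectType K) (U W : {vspace V}) :
  (U <= W)%VS ->
  exists n (q : 'Hom(V, 'rV[K]_n)) (s : 'Hom('rV[K]_n, V)),
  [/\ n = (\dim W - \dim U)%N,
      forall v, v \in W -> (q v == 0) = (v \in U),
      forall r, s r \in W &
      forall r, q (s r) = r].
Proof.
move=> sUW; set X := (W :\: U)%VS; set e := vbasis X.
have XU0 : (X :&: U = 0)%VS by apply: capv_diff.
have efree : free e by apply: basis_free (vbasisP X).
pose rVof v : 'rV_(\dim X) := \row_i coord e i v.
pose vecof (r : 'rV_(\dim X)) := \sum_i r 0 i *: e`_i.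
have rVof_lin : linear rVof.
  by move=> a u v; apply/rowP => i; rewrite !mxE linearP.
have vecof_lin : linear vecof.
  move=> a u v; rewrite scaler_sumr -big_split.
  by apply: eq_bigr => i _; rewrite !mxE scalerDl scalerA.
pose rVof_l := HB.pack_for {linear V -> 'rV_(\dim X)} rVof
  (GRing.isLinear.Build _ _ _ _ rVof rVof_lin).
pose vecof_l := HB.pack_for {linear 'rV_(\dim X) -> V} vecof
  (GRing.isLinear.Build _ _ _ _ vecof vecof_lin).
exists (\dim X), (linfun rVof_l \o daddv_pi X U)%VF, (linfun vecof_l).
have sX r : vecof r \in X.
  by apply: memv_suml => i _; rewrite memvZ // vbasis_mem // mem_nth //
    size_tuple.
split.
- by rewrite -(dimv_cap_compl W U) (capv_idPr sUW) addKn.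
- move=> v Wv; rewrite comp_lfunE lfunE /=; set x := daddv_pi X U v.
  have Xx : x \in X by apply: memv_pi.
  have vE : x + daddv_pi U X v = v.
    by rewrite daddv_pi_add // addv_diff (addv_idPl sUW).
  have -> : (rVof x == 0) = (x == 0).
    apply/eqP/eqP => [x0|->]; last exact: (linear0 rVof_l).
    rewrite (coord_vbasis Xx) big1 // => i _.
    by have /rowP/(_ i) := x0; rewrite !mxE => ->; rewrite scale0r.
  apply/eqP/idP => [x0|Uv]; first by rewrite -vE x0 add0r memv_pi.
  apply/eqP; rewrite -memv0 -XU0 memv_cap Xx /=.
  by rewrite -[x](addrK (daddv_pi U X v)) vE memvB ?memv_pi.
- by move=> r; rewrite lfunE /= (subvP (diffvSl W U)).
- move=> r; rewrite comp_lfunE !lfunE /= daddv_pi_id //.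
  by apply/rowP => i; rewrite mxE coord_sum_free.
Qed.

(** * Commuting operators on a quotient space *)

Section DiagonalFamily.
Variables (C : numClosedFieldType) (V E : vectType C).
Variables (rho : {linear E -> 'End(V)}) (S : {vspace E}) (U W : {vspace V}).
Hypothesis sUW : (U <= W)%VS.
Hypothesis rhoW : forall e v, e \in S -> v \in W -> rho e v \in W.
Hypothesis rhoU : forall e v, e \in S -> v \in U -> rho e v \in U.
Hypothesis rho_comm : forall e e' v, e \in S -> e' \in S -> v \in W ->
  rho e (rho e' v) - rho e' (rho e v) \in U.
Hypothesis rho_nil : forall e m, e \in S ->
  (forall v, v \in W -> iter m (rho e) v \in U) -> e = 0.
Hypothesis dimS : (\dim W - \dim U <= \dim S)%N.

(** Serves twice: for even elements of the extension acting on I/[I, I], and for a torus acting on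
    N/[N, N]. *)
Lemma diagonal_family : exists n (b : 'I_n -> V),
  [/\ forall i, b i \in W,
      forall e, e \in S -> exists d, forall i, rho e (b i) - d i *: b i \in U,
      forall d, exists2 e, e \in S & forall i, rho e (b i) - d i *: b i \in U,
      forall v, v \in W -> exists c, v - \sum_i c i *: b i \in U &
      forall c, \sum_i c i *: b i \in U -> forall i, c i = 0].
Proof.
have [n [q [s [nE qU sW sK]]]] := quotient_coordinates sUW.
pose M e := lin1_mx (q \o (rho e \o s))%VF.
have ME e v : v *m M e = q (rho e (s v)).
  by rewrite mul_rV_lin1 /= !comp_lfunE.
have qM e v : e \in S -> v \in W -> q (rho e v) = q v *m M e.
  move=> Se Wv; apply/eqP; rewrite ME -subr_eq0 -!linearB qU ?rhoW ?memvB //.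
  by rewrite rhoU // -qU ?memvB // linearB /= sK subrr.
have mxP (A B : 'M[C]_n) : (forall v : 'rV_n, v *m A = v *m B) -> A = B.
  by move=> AB; apply/row_matrixP => i; rewrite !rowE AB.
have M_lin : linear M.
  move=> a e e'; apply: mxP => v; rewrite mulmxDr -scalemxAr !ME.
  by rewrite linearP add_lfunE scale_lfunE linearP.
pose Mf := HB.pack_for {linear E -> 'M[C]_n} M
  (GRing.isLinear.Build _ _ _ _ M M_lin).
have MfE e : linfun Mf e = M e by rewrite lfunE.
have M_nil e m : e \in S -> (forall v : 'rV_n, iter m (mulmx^~ (M e)) v = 0) ->
    e = 0.
  move=> Se Mm; apply: (@rho_nil e m Se) => v Wv.
  have [] : iter m (rho e) v \in W /\
      q (iter m (rho e) v) = iter m (mulmx^~ (M e)) (q v).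
    elim: (m) => [|k [Wk IHk]] //=; split; first exact: rhoW.
    by rewrite qM // IHk.
  by move=> Wm; rewrite Mm => /eqP; rewrite qU.
have [||| P Pu [PM MP]] := @commuting_diagonalizable C n (linfun Mf @: S)%VS.
- move=> _ _ /memv_imgP[e Se ->] /memv_imgP[e' Se' ->]; rewrite !MfE.
  apply: mxP => v; rewrite !mulmxA -[v]sK -!qM ?rhoW ?sW //.
  apply/eqP; rewrite -subr_eq0 -linearB qU; first by apply: rho_comm.
  by rewrite memvB ?rhoW.
- by move=> _ /memv_imgP[e Se ->] [m]; rewrite MfE => /(M_nil _ _ Se) ->;
    rewrite -MfE linear0.
(* An element with zero matrix is nilpotent on the quotient with exponent 1, hence 0; so [S] keeps
   its dimension. *)
- rewrite limg_dim_eq ?nE //; apply/eqP; rewrite -subv0.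
  apply/subvP => e /memv_capP[Se]; rewrite memv_ker MfE memv0 => /eqP Me0.
  by apply/eqP/(@M_nil e 1 Se) => v /=; rewrite Me0 mulmx0.
(* Matrices act on row vectors, so the rows of [P] are the common eigenvectors. *)
pose b i := s (row i P).
have q_comb (c : 'I_n -> C) : q (\sum_i c i *: b i) = (\row_i c i) *m P.
  rewrite linear_sum mulmx_sum_row; apply: eq_bigr => i _.
  by rewrite linearZ /= sK mxE.
have comb_W (c : 'I_n -> C) : \sum_i c i *: b i \in W.
  by apply: memv_suml => i _; apply/memvZ/sW.
have diagE e (d : 'rV_n) i : e \in S -> P *m M e = diag_mx d *m P ->
    rho e (b i) - d 0 i *: b i \in U.
  move=> Se /(congr1 (row i)); rewrite !row_mul row_diag_mx -scalemxAl -rowE => Pd.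
  have sbi : b i \in W by apply: sW.
  rewrite -qU; last by rewrite memvB ?memvZ ?rhoW.
  by rewrite linearB linearZ /= -ME sK Pd subrr.
exists n, b; split=> [i | e Se | d | v Wv | c Uc i].
- exact: sW.
- have [|d] := PM (M e); first by rewrite -MfE memv_img.
  by move=> Pd; exists (d 0) => i; apply: diagE.
- have [_ /memv_imgP[e Se ->]] := MP (\row_i d i); rewrite MfE => Pd.
  by exists e => // i; have := diagE e _ i Se Pd; rewrite mxE.
- exists ((q v *m invmx P) 0); rewrite -qU ?memvB // linearB /= q_comb.
  rewrite (_ : \row_i _ = q v *m invmx P) ?mulmxKV ?subrr //.
  by apply/rowP => i; rewrite [LHS]mxE.
- move: Uc; rewrite -qU // q_comb => /eqP/(congr1 (mulmx^~ (invmx P))).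
  by rewrite mulmxK // mul0mx => /rowP/(_ i); rewrite !mxE.
Qed.

End DiagonalFamily.

(** * Superderivations of the extension *)

Section Superderivations.
Variables (F : numFieldType) (L : lieSuperalgebra F).
Implicit Types (x y z : L) (d : 'End(L)).

Lemma superderivation_of_degreeB i d d' :
  superderivation_of_degree i d -> superderivation_of_degree i d' ->
  superderivation_of_degree i (d - d').
Proof.
move=> [dgr dbr] [d'gr d'br]; split=> [j x grx|j x y grx];
  rewrite !add_lfunE !opp_lfunE ?memvB ?dgr ?d'gr //.
rewrite (dbr j) // (d'br j) // brBl brBr scalerBr opprD.
by rewrite addrACA.
Qed.

Lemma lsa_ad_superderivation i x : x \in lsa_gr L i ->
  superderivation_of_degree i (lsa_ad x).
Proof.
move=> grx; split=> [j y gry|j y z gry]; rewrite !lsa_adE ?lsa_br_gr //.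
exact: lsa_br_jacobi.
Qed.

Lemma superderivationB_ad d z :
  superderivation d -> superderivation (d - lsa_ad z).
Proof.
case=> d0 [d1 [d0P d1P ->]].
exists (d0 - lsa_ad (parity_part false z)), (d1 - lsa_ad (parity_part true z)).
split; try by
  apply/superderivation_of_degreeB/lsa_ad_superderivation/parity_part_mem.
by rewrite -{1}(parity_partC false z) linearD opprD addrACA.
Qed.

Lemma superderivation_br_even d x y : superderivation d ->
  x \in lsa_gr L false -> d [< x, y >] = [< d x, y >] + [< x, d y >].
Proof.
case=> d0 [d1 [[_ d0P] [_ d1P] ->]] grx; rewrite !add_lfunE brDl brDr.
by rewrite (d0P _ _ _ grx) (d1P _ _ _ grx) !andbF !expr0 !scale1r addrACA.
Qed.

(** [x] may be inhomogeneous: the sign depending on parity multiplies only brackets with [d y],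
    which vanish, and the rest adds up to [[d x, y]]. *)
Lemma superderivation_of_degree_br0 i d x y : superderivation_of_degree i d ->
  d x = 0 -> d y = 0 -> d [< x, y >] = 0.
Proof.
move=> [_ dP] dx dy; have := br0l y; rewrite -{1}dx -{1}(parity_partC true x).
rewrite linearD brDl /= => dxy; rewrite -(parity_partC true x) brDl linearD /=.
rewrite !(dP _ _ _ (parity_part_mem _ x)) dy !br0r !scaler0 !addr0.
exact: dxy.
Qed.

End Superderivations.

(** The kernel of [d] meets every class of I/[I, I], and such elements generate a nilpotent [I]. *)
Lemma superderivation_of_degree_eq0 (F : numFieldType) (L : lieSuperalgebra F)
    (I : {vspace L}) i (d : 'End(L)) :
  lsa_ideal I -> lsa_nilpotent I -> superderivation_of_degree i d ->
  (forall x, x \in I -> exists2 y, y \in lcs I 1 & d (x - y) = 0) ->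
  forall x, x \in I -> d x = 0.
Proof.
move=> I_ideal [n In0] dP d_gen.
(* Every layer is spanned by elements killed by [d], modulo the next layer; descending from layer
   [n], which is 0, puts all layers into the kernel. *)
have lift k : (lcs I k <= (lcs I k :&: lker d) + lcs I k.+1)%VS.
  elim: k => [|k IHk].
    apply/subvP => x Ix; have [y Uy dy] := d_gen x Ix.
    rewrite -(subrK y x) memv_add // memv_cap memv_ker dy eqxx andbT.
    by rewrite memvB // (subvP (lcs_sub I_ideal 1)).
  apply/lsa_brv_subP => u w Cu Iw.
  have /memv_addP[u1 /memv_capP[Cu1 du1] [u2 Cu2 ->]] := subvP IHk u Cu.
  have [w2 Uw2 dw1] := d_gen w Iw.
  have Iw2 : w2 \in I by rewrite (subvP (lcs_sub I_ideal 1)).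
  rewrite -(subrK w2 w) brDl brDr -addrA memv_add //.
    have Cuw : [< u1, w - w2 >] \in lcs I k.+1 by apply: lcs_br; rewrite ?memvB.
    rewrite memv_cap Cuw memv_ker /=.
    by rewrite (superderivation_of_degree_br0 dP) //; apply/eqP; rewrite -memv_ker.
  apply: memvD; first exact: lcs_br1.
  by apply: lcs_br; rewrite ?subrK.
have I_ker k : (k <= n)%N -> (lcs I (n - k) <= lker d)%VS.
  elim: k => [|k IHk] kn; first by rewrite subn0 /lcs In0 sub0v.
  apply: subv_trans (lift _) _; rewrite subv_add capvSr /=.
  by rewrite subnSK // IHk // ltnW.
move=> x Ix; apply/eqP; rewrite -memv_ker; apply: (subvP (I_ker n (leqnn n))).
by rewrite subnn.
Qed.

Lemma shift_of_generators (F : fieldType) (V : vectType F) (D : 'End(V))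
    (U : {vspace V}) n (b : 'I_n -> V) (v : V) :
  (forall u, u \in U -> D u \in U) -> (forall i, D (b i) - b i \in U) ->
  (exists c : 'I_n -> F, v - \sum_i c i *: b i \in U) -> D v - v \in U.
Proof.
move=> DU Db [c vc]; set s := \sum_i _ in vc.
have -> : D v - v = D (v - s) - (v - s) + (D s - s).
  by rewrite linearB /= addrACA subrK -opprD subrK.
apply: memvD; first by rewrite memvB ?DU.
rewrite /s linear_sum -sumrB memv_suml // => i _.
by rewrite linearZ /= -scalerBr memvZ.
Qed.

(** * Extensions of codimension at least dim I/[I, I] *)

Section CompleteExtension.
Variables (C : numClosedFieldType) (L : lieSuperalgebra C) (I : {vspace L}).
Hypothesis I_nilrad : lsa_nilradical I.
Hypothesis LL_I : (lsa_brv {: L} {: L} <= I)%VS.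

Let I_ideal : lsa_ideal I. Proof. by case: I_nilrad. Qed.
Let I_nilp : lsa_nilpotent I. Proof. by case: I_nilrad. Qed.

Let L0I_full : (lsa_gr L false + I = fullv)%VS.
Proof.
apply/eqP; rewrite eqEsubv subvf -lsa_gr_full subv_add addvSl.
by rewrite (subv_trans _ (addvSr _ _)) // odd_sub_nilradical.
Qed.

Lemma weight_family :
  (\dim I - \dim (lcs I 1) <= \dim {: L} - \dim I)%N ->
  exists n (b : 'I_n -> L),
  [/\ forall i, b i \in I,
      forall t, t \in lsa_gr L false ->
        exists a, forall i, [< t, b i >] - a i *: b i \in lcs I 1,
      forall a, exists2 t, t \in lsa_gr L false &
        forall i, [< t, b i >] - a i *: b i \in lcs I 1,
      forall v, v \in I -> exists c : 'I_n -> C,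
        v - \sum_i c i *: b i \in lcs I 1 &
      forall c : 'I_n -> C, \sum_i c i *: b i \in lcs I 1 -> forall i, c i = 0].
Proof.
(* As L_1 <= I, a complement of [I] in L_0 spans L together with [I] and has dimension dim L - dim
   I. *)
move=> dim_le; pose S := (lsa_gr L false :\: I)%VS.
have S0 e : e \in S -> e \in lsa_gr L false by apply: subvP; apply: diffvSl.
have SI : (S + I)%VS = fullv by rewrite addv_diff L0I_full.
have [||||||n [b [Ib diag_b b_diag genb freeb]]] :=
  @diagonal_family C L L (@lsa_ad _ L) S (lcs I 1) I.
- exact: lcs_sub.
- by move=> e v _; rewrite /= lsa_adE; apply: ideal_brr.
- by move=> e v _; rewrite /= lsa_adE; apply: lcs_brr.
- move=> e e' v /S0 gre /S0 gre' Iv; rewrite /= !lsa_adE.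
  rewrite (lsa_br_jacobi v gre gre') expr0 scale1r addrK.
  by rewrite (@lcs_br _ _ _ 0) ?br_nilradical.
- move=> e m Se Dm; apply/eqP; rewrite -memv0 -(capv_diff (lsa_gr L false) I).
  by rewrite memv_cap Se (even_nilradical_mem I_nilrad LL_I (S0 e Se) Dm).
- apply: leq_trans dim_le _; rewrite -SI dimv_disjoint_sum ?capv_diff //.
  by rewrite addnK.
exists n, b; split=> // [t _|a].
  (* Elements of [I] act as 0 on I/[I, I], so only the component in [S] matters. *)
  have: t \in (S + I)%VS by rewrite SI memvf.
  case/memv_addP=> e Se [y Iy ->]; have [a ea] := diag_b e Se.
  exists a => i; rewrite brDl addrAC memvD //.
    by have := ea i; rewrite /= lsa_adE.
  by rewrite (@lcs_br _ _ _ 0).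
have [e Se ea] := b_diag a; exists e; first exact: S0.
by move=> i; have := ea i; rewrite /= lsa_adE.
Qed.

Section WeightBasis.
Variables (n : nat) (b : 'I_n -> L).
Hypothesis Ib : forall i, b i \in I.
Hypothesis b_weight : forall t, t \in lsa_gr L false ->
  exists a, forall i, [< t, b i >] - a i *: b i \in lcs I 1.
Hypothesis weight_b : forall a, exists2 t, t \in lsa_gr L false &
  forall i, [< t, b i >] - a i *: b i \in lcs I 1.
Hypothesis b_gen : forall v, v \in I -> exists c : 'I_n -> C,
  v - \sum_i c i *: b i \in lcs I 1.
Hypothesis b_free : forall c : 'I_n -> C,
  \sum_i c i *: b i \in lcs I 1 -> forall i, c i = 0.

Lemma euler_element : exists2 h, h \in lsa_gr L false &
  forall x, x \in I -> lsa_ad h x - x \in lcs I 1.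
Proof.
have [h grh hb] := weight_b (fun=> 1); exists h => // x Ix.
apply: shift_of_generators (b_gen Ix) => [u|i]; rewrite lsa_adE.
  exact: lcs_brr.
by have := hb i; rewrite scale1r.
Qed.

Section Euler.
Variable h : L.
Hypothesis grh : h \in lsa_gr L false.
Hypothesis hI : forall x, x \in I -> lsa_ad h x - x \in lcs I 1.

Let h_der := lsa_ad_even grh.
Let sub1 x : x \in lcs I 1 -> x \in I.
Proof. exact: subvP (lcs_sub I_ideal 1) x. Qed.

Let h_inj x : x \in I -> [< h, x >] = 0 -> x = 0.
Proof. by rewrite -lsa_adE; apply: (shift_inj I_ideal h_der I_nilp hI). Qed.

Let h_onto x : x \in I -> exists2 y, y \in I & [< h, y >] = x.
Proof.
move/(shift_onto I_ideal h_der I_nilp hI) => [y Iy <-].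
by exists y; rewrite ?lsa_adE.
Qed.

Let h_fix_eq0 x : x \in lcs I 1 -> [< h, x >] = x -> x = 0.
Proof. by rewrite -lsa_adE; apply: (shift_fix_eq0 I_ideal h_der I_nilp hI). Qed.

Let h_fix_part x : x \in I ->
  exists2 y, y \in lcs I 1 & [< h, x - y >] = x - y.
Proof.
by move/(shift_fix_part I_ideal h_der I_nilp hI)=> [y]; rewrite lsa_adE; exists y.
Qed.

Let h_parity i x : [< h, parity_part i x >] = parity_part i [< h, x >].
Proof.
rewrite -{2}(parity_partC i x) brDr linearD /=.
have gr j y : [< h, parity_part j y >] \in lsa_gr L j.
  exact: (lsa_br_gr grh (parity_part_mem j y)).
by rewrite (parity_part_id (gr _ _)) (parity_part_eq0 (gr _ _)) addr0.
Qed.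

(** The odd part of [t] lies in [I] and commutes with [h], which acts injectively on [I]. *)
Let cent_even t : [< h, t >] = 0 -> t \in lsa_gr L false.
Proof.
move=> ht; rewrite -(parity_partC false t) memvD ?parity_part_mem //.
rewrite (_ : parity_part _ t = 0) ?mem0v //; apply: h_inj.
  apply: (subvP (odd_sub_nilradical I_nilrad LL_I)); exact: parity_part_mem.
by rewrite h_parity ht linear0.
Qed.

(** [[h, x]] lies in [I], where [h] is onto; subtracting a preimage leaves an element of the
    centralizer of [h]. *)
Let decomp x : exists2 t, [< h, t >] = 0 & x - t \in I.
Proof.
have [y Iy hy] := h_onto (br_nilradical LL_I h x).
by exists (x - y); rewrite ?brBr ?hy ?subrr // opprB addrCA subrr addr0.
Qed.

Let fix_basis : exists x : 'I_n -> L,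
  [/\ forall i, x i \in I, forall i, [< h, x i >] = x i &
      forall i, b i - x i \in lcs I 1].
Proof.
have /fin_all_exists[x xP] i : exists x,
    [/\ x \in I, [< h, x >] = x & b i - x \in lcs I 1].
  have [y Uy hy] := h_fix_part (Ib i); exists (b i - y).
  split=> //; first exact: memvB (Ib i) (sub1 Uy).
  by rewrite opprB addrCA subrr addr0.
by exists x; split=> i; have [] := xP i.
Qed.

Section Basis.
Variable x : 'I_n -> L.
Hypothesis Ix : forall i, x i \in I.
Hypothesis hx : forall i, [< h, x i >] = x i.
Hypothesis bx : forall i, b i - x i \in lcs I 1.

Let sum_bx (c : 'I_n -> C) : \sum_i c i *: b i - \sum_i c i *: x i \in lcs I 1.
Proof.
by rewrite -sumrB memv_suml // => i _; rewrite -scalerBr memvZ.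
Qed.

Let h_sum (c : 'I_n -> C) : [< h, \sum_i c i *: x i >] = \sum_i c i *: x i.
Proof.
rewrite -lsa_adE linear_sum; apply: eq_bigr => i _.
by rewrite linearZ /= lsa_adE hx.
Qed.

Let x_gen v : v \in I -> [< h, v >] = v ->
  exists c : 'I_n -> C, v = \sum_i c i *: x i.
Proof.
move=> Iv hv; have [c vc] := b_gen Iv; exists c; apply/eqP; rewrite -subr_eq0.
apply/eqP/h_fix_eq0; last by rewrite brBr hv h_sum.
rewrite -(subrK (\sum_i c i *: b i) v) -addrA memvD //.
Qed.

Let x_free (c : 'I_n -> C) : \sum_i c i *: x i = 0 -> forall i, c i = 0.
Proof.
by move=> cx; apply: b_free; have := sum_bx c; rewrite cx subr0.
Qed.

(** The difference of the two sides lies in [lcs I 1] and is fixed by [h], so a congruence modulo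
    [I, I] becomes an equality. *)
Let weight_eq t a i : [< h, t >] = 0 ->
  [< t, b i >] - a *: b i \in lcs I 1 -> [< t, x i >] = a *: x i.
Proof.
move=> ht tb; apply/eqP; rewrite -subr_eq0; apply/eqP/h_fix_eq0.
  have -> : [< t, x i >] - a *: x i =
      [< t, b i >] - a *: b i - ([< t, b i - x i >] - a *: (b i - x i)).
    rewrite brBr scalerBr.
    rewrite -[LHS](subKr ([< t, b i >] - a *: b i)); congr (_ - _).
    by rewrite !opprB addrACA [RHS]addrACA [X in _ + X]addrC.
  by rewrite memvB // memvB ?memvZ ?lcs_brr.
rewrite brBr brZr hx -lsa_adE h_der !lsa_adE ht br0l add0r hx //.
Qed.

Let x_weight t : [< h, t >] = 0 -> exists a, forall i, [< t, x i >] = a i *: x i.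
Proof.
move=> ht; have [a ta] := b_weight (cent_even ht).
by exists a => i; apply: weight_eq.
Qed.

Let weight_x a : exists2 t, [< h, t >] = 0 & forall i, [< t, x i >] = a i *: x i.
Proof.
have [t grt ta] := weight_b a; have [s hs Its] := decomp t; exists s => // i.
apply: weight_eq => //; rewrite -[s](subKr t) brBl addrAC memvB //.
by rewrite (@lcs_br _ _ _ 0).
Qed.

(** Such a [t] acts as 0 on I/[I, I], hence lies in the nilradical, on which [h] is injective. *)
Let cent_faithful t : [< h, t >] = 0 -> (forall i, [< t, x i >] = 0) -> t = 0.
Proof.
move=> ht tx; apply: h_inj (ht).
apply: (@even_nilradical_mem _ _ _ I_nilrad LL_I t 1 (cent_even ht)) => v Iv /=.
rewrite lsa_adE; have [y Uy hy] := h_fix_part Iv.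
have [c vc] := x_gen (memvB Iv (sub1 Uy)) hy.
rewrite -(subrK y v) brDr memvD //; last by rewrite lcs_brr.
rewrite vc -lsa_adE linear_sum big1 ?mem0v //.
by move=> i _; rewrite linearZ /= lsa_adE tx scaler0.
Qed.

Let center_trivial : lsa_center_trivial L.
Proof.
move=> z z0; apply: cent_faithful => [|i]; last exact: z0.
by have := br_even_odd z grh; rewrite z0 => /eqP; rewrite eq_sym oppr_eq0 => /eqP.
Qed.

Let der_eq0 (d : 'End(L)) : superderivation d ->
  (forall t, [< h, t >] = 0 -> d t = 0) -> (forall i, d (x i) = 0) -> d = 0.
Proof.
case=> d0 [d1 [d0P d1P ->]] dH dx.
(* On a homogeneous vector the values of [d0] and [d1] have opposite parities, so they cannot
   cancel. *)
have split_eq0 v : (forall i, (d0 + d1) (parity_part i v) = 0) ->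
    d0 v = 0 /\ d1 v = 0.
  move=> dv; have hom i : d0 (parity_part i v) = 0 /\ d1 (parity_part i v) = 0.
    have gr0 := d0P.1 _ _ (parity_part_mem i v).
    have gr1 := d1P.1 _ _ (parity_part_mem i v).
    have := dv i; rewrite add_lfunE => /eqP; rewrite addr_eq0 => /eqP e01.
    suff z : d0 (parity_part i v) = 0.
      by split=> //; apply/eqP; rewrite -oppr_eq0 -e01 z.
    have z1 : parity_part (false (+) i) (d1 (parity_part i v)) = 0.
      by apply: parity_part_eq0; case: (i) gr1.
    by rewrite -(parity_part_id gr0) e01 linearN /= z1 oppr0.
  rewrite -(parity_partC true v) !linearD /=.
  by case: (hom true) (hom (~~ true)) => -> -> [-> ->]; rewrite !addr0.
have dI v : v \in I ->
    exists2 y, y \in lcs I 1 & d0 (v - y) = 0 /\ d1 (v - y) = 0.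
  move=> Iv; have [y Uy hy] := h_fix_part Iv; exists y => //.
  apply: split_eq0 => i; have [||c ->] := @x_gen (parity_part i (v - y)).
  - by apply: (lsa_gradedP I).1; [case: I_ideal | exact: memvB Iv (sub1 Uy)].
  - by rewrite h_parity hy.
  by rewrite linear_sum big1 // => j _; rewrite linearZ /= dx scaler0.
have dH01 t : [< h, t >] = 0 -> d0 t = 0 /\ d1 t = 0.
  by move=> ht; apply: split_eq0 => i; rewrite dH // h_parity ht linear0.
have d0I : forall v, v \in I -> d0 v = 0.
  apply: superderivation_of_degree_eq0 d0P _ => // v /dI[y Uy []].
  by exists y.
have d1I : forall v, v \in I -> d1 v = 0.
  apply: superderivation_of_degree_eq0 d1P _ => // v /dI[y Uy []].
  by exists y.
apply/lfunP => v; have [t ht Ivt] := decomp v; rewrite zero_lfunE.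
rewrite -(subrK t v) linearD /= (dH _ ht) addr0.
by rewrite add_lfunE d0I ?d1I ?addr0.
Qed.

(** Applying [d] to [[h, x i] = x i] gives [d (x i) = a i *: x i + [h, d (x i)]]. As [h] is the
    identity modulo [I, I], [a i *: x i] lies in [lcs I 1]; being fixed by [h] it is 0, so [d h]
    kills all generators. *)
Let der_cent_shift (d : 'End(L)) : superderivation d ->
  [< h, d h >] = 0 -> d h = 0.
Proof.
move=> dP hdh; have [a ha] := x_weight hdh; apply: cent_faithful => // i.
have dxi : d (x i) = a i *: x i + [< h, d (x i) >].
  by rewrite -ha -superderivation_br_even // hx.
have Idx : d (x i) \in I.
  by rewrite dxi memvD ?memvZ // br_nilradical.
rewrite ha; apply: h_fix_eq0; last by rewrite brZr hx.
have := hI Idx; rewrite lsa_adE {2}dxi opprD addrCA subrr addr0 memvN.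
by [].
Qed.

(** As [d h = 0], [d] commutes with [lsa_ad h] and preserves its 0- and 1-eigenspaces. *)
Let der_diag (d : 'End(L)) : superderivation d -> d h = 0 ->
  (forall t, [< h, t >] = 0 -> d t = 0) /\
  exists a, forall i, d (x i) = a i *: x i.
Proof.
move=> dP dh.
have hd y : d [< h, y >] = [< h, d y >].
  by rewrite superderivation_br_even // dh br0l add0r.
have dHH t : [< h, t >] = 0 -> [< h, d t >] = 0.
  by move=> ht; rewrite -hd ht linear0.
have /fin_all_exists[g dx] i : exists g, d (x i) = \sum_j g j *: x j.
  have hdx : [< h, d (x i) >] = d (x i) by rewrite -hd hx.
  by apply: x_gen; rewrite // -hdx br_nilradical.
(* Compares coefficients of [x j] in [d] applied to [[t, x i] = a i *: x i]. The case [j = i] yields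
   [c i = 0]. *)
have rel t a c i j : [< h, t >] = 0 -> (forall i, [< t, x i >] = a i *: x i) ->
    (forall i, [< d t, x i >] = c i *: x i) ->
    a i * g i j = (if j == i then c i else 0) + g i j * a j.
  move=> ht ta tc; have := superderivation_br_even (x i) dP (cent_even ht).
  rewrite ta tc linearZ /= dx => /eqP; rewrite -subr_eq0 => /eqP rel0.
  apply/eqP; rewrite -subr_eq0; apply/eqP; move: j; apply: x_free.
  rewrite -[RHS]rel0 -lsa_adE !linear_sum /=.
  under [in LHS]eq_bigr do rewrite scalerBl scalerDl.
  rewrite sumrB big_split /=; congr (_ - (_ + _)).
  - by apply: eq_bigr => j _; rewrite scalerA.
  - by rewrite (bigD1 i) //= eqxx big1 ?addr0 // => j /negPf->; rewrite scale0r.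
  by apply: eq_bigr => j _; rewrite linearZ /= lsa_adE ta scalerA.
split=> [t ht|].
  have [a ta] := x_weight ht; have [c tc] := x_weight (dHH t ht).
  apply: cent_faithful => [|i]; first exact: dHH.
  have := rel t a c i i ht ta tc; rewrite eqxx mulrC => /eqP.
  by rewrite -subr_eq0 opprD addrCA subrr addr0 oppr_eq0 tc => /eqP->; rewrite scale0r.
exists (fun i => g i i) => i; rewrite dx (bigD1 i) //= big1 ?addr0 // => j ji.
(* A [t] of weight 1 on [x i] and 0 on the others turns [rel] into [g i j = 0]. *)
have [t ht ta] := weight_x (fun k => (k == i)%:R).
have [c tc] := x_weight (dHH t ht).
have := rel t _ c i j ht ta tc.
by rewrite (negPf ji) eqxx mul1r mulr0 addr0 => ->; rewrite scale0r.
Qed.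

Let der_inner (d : 'End(L)) : superderivation d -> inner_superderivation d.
Proof.
move=> dP; have [t0 ht0 Idh] := decomp (d h).
(* Since [[- w, h] = [h, w]], subtracting [lsa_ad (- w)] removes the [I]-component of [d h]; what
   remains commutes with [h], hence is 0. *)
have [w Iw hw] := h_onto Idh.
have d1P := superderivationB_ad (- w) dP.
have d1h : (d - lsa_ad (- w)) h = t0.
  rewrite add_lfunE opp_lfunE lsa_adE (br_even_odd _ grh) brNr opprK hw.
  by rewrite opprB addrCA subrr addr0.
have d1h0 : (d - lsa_ad (- w)) h = 0.
  by apply: der_cent_shift; rewrite ?d1h.
have [dH [a dx]] := der_diag d1P d1h0.
(* The remaining derivation is diagonal on the generators, and [s] acts on them by the same
   scalars. *)
have [s hs sx] := weight_x a.
exists (- w + s) => y; rewrite -lsa_adE; congr (fun_of_lfun _ _).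
apply/eqP; rewrite linearD -subr_eq0 opprD addrA; apply/eqP.
apply: der_eq0 => [|t ht|i]; first exact: superderivationB_ad.
  (* The centralizer of [h] is abelian: [[s, t]] lies in [I] and commutes with [h]. *)
  rewrite add_lfunE opp_lfunE dH // add0r lsa_adE; apply/eqP.
  rewrite oppr_eq0; apply/eqP/h_inj; first exact: br_nilradical.
  by rewrite -lsa_adE h_der !lsa_adE hs ht br0l br0r addr0.
by rewrite add_lfunE opp_lfunE dx lsa_adE sx subrr.
Qed.

Lemma weight_basis_complete : lsa_center_trivial L /\
  forall d : 'End(L), superderivation d -> inner_superderivation d.
Proof. by split=> [z|d]; [apply: center_trivial | apply: der_inner]. Qed.

End Basis.

Lemma euler_complete : lsa_center_trivial L /\
  forall d : 'End(L), superderivation d -> inner_superderivation d.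
Proof. by have [x [Ix hx bx]] := fix_basis; apply: weight_basis_complete bx. Qed.

End Euler.
End WeightBasis.

Lemma nilradical_complete :
  (\dim I - \dim (lcs I 1) <= \dim {: L} - \dim I)%N ->
  lsa_center_trivial L /\
  forall d : 'End(L), superderivation d -> inner_superderivation d.
Proof.
case/weight_family=> n [b [Ib b_weight weight_b b_gen b_free]].
have [h grh hI] := euler_element weight_b b_gen.
exact: (euler_complete Ib b_weight weight_b b_gen b_free grh hI).
Qed.

End CompleteExtension.

(** * Extension by a torus *)

Lemma coord_inj (F : fieldType) (V : vectType F) (u v : V) :
  (forall k, coord (vbasis {: V}) k u = coord (vbasis {: V}) k v) -> u = v.
Proof.
move=> uv; rewrite (coord_vbasis (memvf u)) (coord_vbasis (memvf v)).
by apply: eq_bigr => k _; rewrite uv.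
Qed.

(** Taking coordinates reduces an identity of linear combinations to one between scalars. *)
Ltac vector_ring :=
  apply: coord_inj => ?;
  rewrite ?(linearD, linearB, linearN, linearZ, linear0) /=; ring.

Section TorusExtension.
Variables (F : numFieldType) (N : lieSuperalgebra F) (T : {vspace 'End(N)}).
Hypothesis T_torus : lsa_torus T.

Definition torus_ext_sort : vectType F := (subvs_of T * N)%type.
Local Notation X := torus_ext_sort.
Implicit Types (p q r : X).

(* The pair (t, x) stands for t + x, with [t, y] = t y for y in N. *)
Definition torus_ext_br (p q : X) : X :=
  (0, vsval p.1 q.2 - vsval q.1 p.2 + [< p.2, q.2 >]).

(** The torus sits in even degree, so the odd part is that of [N]. *)
Definition torus_ext_gr (i : bool) : {vspace X} :=
  (linfun (fun p : X => p.2) @^-1: lsa_gr N i :&: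
   (if i then lker (linfun (fun p : X => p.1)) else fullv))%VS.

Lemma torus_ext_grP i p :
  reflect (p.2 \in lsa_gr N i /\ (i -> p.1 = 0)) (p \in torus_ext_gr i).
Proof.
rewrite memv_cap -memv_preim lfunE /=.
apply: (iffP andP) => [][gr2 gr1]; split=> //.
  by case: i gr1 {gr2} => //; rewrite memv_ker lfunE => /eqP.
case: i gr1 {gr2} => [/(_ isT) p1|_]; last exact: memvf.
by rewrite memv_ker lfunE /= p1.
Qed.

Let T_even t : t \in T -> even_derivation t.
Proof. by case/T_torus.1 => /superderivation_even. Qed.

Let T_gr t i x : t \in T -> x \in lsa_gr N i -> t x \in lsa_gr N i.
Proof. by case/T_torus.1 => -[t_gr _] _ /t_gr. Qed.

Let T_comm s t x : s \in T -> t \in T -> s (t x) = t (s x).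
Proof. by move=> Ts Tt; rewrite -!comp_lfunE T_torus.2. Qed.

Lemma torus_ext_gr_full : (torus_ext_gr false + torus_ext_gr true)%VS = fullv.
Proof.
apply/eqP; rewrite eqEsubv subvf; apply/subvP => -[t x] _ /=.
have -> : (t, x) = (t, parity_part false x) + (0, parity_part true x) :> X.
  by congr pair; rewrite /= ?addr0 // (parity_partC false).
by apply: memv_add; apply/torus_ext_grP; split; rewrite ?parity_part_mem.
Qed.

Lemma torus_ext_gr_direct :
  (torus_ext_gr false :&: torus_ext_gr true)%VS = 0%VS.
Proof.
apply/eqP; rewrite -subv0; apply/subvP => -[t x].
move=> /memv_capP[/torus_ext_grP[/= x0 _] /torus_ext_grP[/= x1 /(_ isT) ->]].
have : x \in (lsa_gr N false :&: lsa_gr N true)%VS by rewrite memv_cap x0.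
by rewrite lsa_gr_direct !memv0 => /eqP->.
Qed.

Lemma torus_ext_br_linear_r p : linear (torus_ext_br p).
Proof.
move=> a q r; congr pair; rewrite /= ?scaler0 ?addr0 //.
rewrite brDr brZr !linearD !linearZ /= add_lfunE scale_lfunE.
by vector_ring.
Qed.

Lemma torus_ext_br_linear_l q : linear (torus_ext_br^~ q).
Proof.
move=> a p r; congr pair; rewrite /= ?scaler0 ?addr0 //.
rewrite brDl brZl !linearD !linearZ /= add_lfunE scale_lfunE.
by vector_ring.
Qed.

Lemma torus_ext_br_gr i j p q : p \in torus_ext_gr i -> q \in torus_ext_gr j ->
  torus_ext_br p q \in torus_ext_gr (i (+) j).
Proof.
case: p q => [t x] [s y] /torus_ext_grP[/= grx t0] /torus_ext_grP[/= gry s0].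
apply/torus_ext_grP; split=> //=; rewrite memvD ?lsa_br_gr // memvB //.
  by case: i t0 {grx} => [/(_ isT) ->|_]; rewrite ?zero_lfunE ?mem0v ?T_gr ?subvsP.
rewrite addbC.
by case: j s0 {gry} => [/(_ isT) ->|_]; rewrite ?zero_lfunE ?mem0v ?T_gr ?subvsP.
Qed.

Lemma torus_ext_br_skew i j p q : p \in torus_ext_gr i -> q \in torus_ext_gr j ->
  torus_ext_br p q = - ((-1) ^+ (i && j) *: torus_ext_br q p).
Proof.
case: p q => [t x] [s y] /torus_ext_grP[/= grx t0] /torus_ext_grP[/= gry s0].
congr pair; rewrite /= ?scaler0 ?oppr0 // (lsa_br_skew grx gry).
case: i t0 {grx} => [/(_ isT)->|_]; case: j s0 {gry} => [/(_ isT) ->|_];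
  rewrite /= ?zero_lfunE ?expr0 ?expr1; vector_ring.
Qed.

Lemma torus_ext_br_jacobi i j p q r :
  p \in torus_ext_gr i -> q \in torus_ext_gr j ->
  torus_ext_br p (torus_ext_br q r) = torus_ext_br (torus_ext_br p q) r +
    (-1) ^+ (i && j) *: torus_ext_br q (torus_ext_br p r).
Proof.
case: p q r => [t x] [s y] [u z].
move=> /torus_ext_grP[/= grx t0] /torus_ext_grP[/= gry s0].
congr pair; rewrite /= ?scaler0 ?addr0 // !zero_lfunE.
have [[Tt Ts] Tu] := (subvsP t, subvsP s, subvsP u).
rewrite !linearD !linearN /= !(T_even Tt, T_even Ts, T_even Tu).
rewrite !(brDl, brDr, brNl, brNr) (lsa_br_jacobi z grx gry).
rewrite (T_comm _ Ts Tt) (T_comm _ Tu Tt) (T_comm _ Tu Ts).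
rewrite (lsa_br_skew (T_gr Tu grx) gry).
case: i t0 {grx} => [/(_ isT)->|_]; case: j s0 {gry} => [/(_ isT) ->|_];
  rewrite /= ?zero_lfunE ?br0l ?br0r ?linear0 ?expr0 ?expr1; vector_ring.
Qed.

Definition torus_ext : lieSuperalgebra F :=
  @LieSuperalgebra F torus_ext_sort torus_ext_gr torus_ext_br torus_ext_gr_full
    torus_ext_gr_direct torus_ext_br_linear_r torus_ext_br_linear_l
    torus_ext_br_gr torus_ext_br_skew torus_ext_br_jacobi.

End TorusExtension.

Section Embedding.
Variables (F : numFieldType) (N L : lieSuperalgebra F) (f : 'Hom(N, L)).
Hypothesis f_emb : lsa_embedding f.

Lemma limg_brv (U W : {vspace N}) :
  (f @: lsa_brv U W)%VS = lsa_brv (f @: U)%VS (f @: W)%VS.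
Proof.
have [_ _ f_br] := f_emb; apply/eqP; rewrite eqEsubv; apply/andP; split.
  have sUW : (lsa_brv U W <= f @^-1: lsa_brv (f @: U) (f @: W))%VS.
    apply/lsa_brv_subP => u w Uu Ww.
    by rewrite -memv_preim f_br brv_mem ?memv_img.
  by apply/subvP => _ /memv_imgP[v /(subvP sUW) + ->]; rewrite -memv_preim.
apply/lsa_brv_subP => _ _ /memv_imgP[u Uu ->] /memv_imgP[w Ww ->].
by rewrite -f_br memv_img // brv_mem.
Qed.

Lemma limg_lcs (U : {vspace N}) k : (f @: lcs U k)%VS = lcs (f @: U)%VS k.
Proof. by elim: k => // k IHk; rewrite /lcs !iterS -!/(lcs _ _) limg_brv IHk. Qed.

Lemma lsa_nilpotent_limg (U : {vspace N}) :
  lsa_nilpotent U -> lsa_nilpotent (f @: U)%VS.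
Proof.
by case=> n Un0; exists n; rewrite -/(lcs _ _) -limg_lcs /lcs Un0 limg0.
Qed.

End Embedding.

Lemma lsa_solvable_derived (F : numFieldType) (L : lieSuperalgebra F)
    (I : {vspace L}) :
  (lsa_brv {: L} {: L} <= I)%VS -> lsa_nilpotent I -> lsa_solvable L.
Proof.
(* One step takes L into [I]; from then on the derived series stays below the lower central series
   of [I], whence [n.+1]. *)
move=> LL_I [n In0]; exists n.+1; apply/eqP; rewrite -subv0 -In0 -/(lcs I n).
elim: n {In0} => [|n IHn]; first exact: LL_I.
rewrite iterS brv_mono //; apply: subv_trans LL_I; rewrite iterS.
by rewrite brv_mono ?subvf.
Qed.

Lemma lsa_ideal_full (F : numFieldType) (N : lieSuperalgebra F) :
  lsa_ideal (fullv : {vspace N}).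
Proof. by split; [apply/lsa_gradedP/lsa_graded_full | rewrite subvf]. Qed.

Lemma diagonalizable_nilpotent_eq0 (F : fieldType) (V : vectType F)
    (d : 'End(V)) m :
  diagonalizable_end d -> (forall v, iter m d v = 0) -> d = 0.
Proof.
case=> e /span_basis e_full e_eigen dm.
apply/(fullv_lfunP _ _ e_full) => v /e_eigen[a da]; rewrite zero_lfunE da.
have iter_d k : iter k d v = a ^+ k *: v.
  elim: k => [|k IHk] /=; first by rewrite scale1r.
  by rewrite IHk linearZ /= da scalerA exprSr.
have := dm v; rewrite iter_d => /eqP; rewrite scaler_eq0 expf_eq0.
by case/orP=> [/andP[_ /eqP ->]|/eqP ->]; rewrite ?scale0r ?scaler0.
Qed.

(** A torus element nilpotent on N/[N, N] is nilpotent on N, hence 0 by diagonalizability. So the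
    torus acts on N/[N, N] by all diagonal matrices, among them the identity. *)
Lemma maximal_rank_shift (C : numClosedFieldType) (N : lieSuperalgebra C)
    (T : {vspace 'End(N)}) :
  lsa_nilpotent {: N} -> lsa_torus T ->
  (\dim {: N} - \dim (lsa_brv {: N} {: N}) <= \dim T)%N ->
  exists2 h, h \in T & forall v, h v - v \in lcs {: N} 1.
Proof.
move=> N_nilp T_torus dimT; have N_ideal := lsa_ideal_full N.
have T_even t : t \in T -> even_derivation t.
  by case/T_torus.1 => /superderivation_even.
have T_lcs t k v : t \in T -> v \in lcs {: N} k -> t v \in lcs {: N} k.
  by move=> Tt; apply: der_lcs => // [|w _]; [apply: T_even | apply: memvf].
have [||||||n [b [_ _ b_diag b_gen _]]] :=
  @diagonal_family C N 'End(N) idfun T (lcs {: N} 1) {: N}.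
- exact: subvf.
- by move=> *; apply: memvf.
- by move=> t v Tt; apply: T_lcs.
- move=> s t v Ts Tt _; rewrite /= -!comp_lfunE T_torus.2 //.
  by rewrite subrr mem0v.
- move=> t m Tt tm.
  have [||M tM] := @der_nilpotent _ _ _ N_ideal _ (T_even t Tt) m N_nilp.
  + by move=> *; apply: memvf.
  + exact: tm.
  apply: diagonalizable_nilpotent_eq0 (T_torus.1 t Tt).2 _ => v.
  exact: tM (memvf v).
- exact: dimT.
have [h Th hb] := b_diag (fun=> 1); exists h => // v.
apply: shift_of_generators (b_gen v (memvf v)) => [u Uu|i]; first exact: T_lcs.
by have := hb i; rewrite scale1r.
Qed.

(** * The torus extension as a competitor for maximality *)

Section TorusExtensionProperties.
Variables (F : numFieldType) (N : lieSuperalgebra F) (T : {vspace 'End(N)}).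
Hypothesis T_torus : lsa_torus T.
Hypothesis N_nilp : lsa_nilpotent {: N}.

Local Notation L := (torus_ext T_torus).

Let N_ideal := lsa_ideal_full N.

Definition torus_ext_inr (x : N) : torus_ext_sort T := (0, x).

Lemma torus_ext_inr_linear : linear torus_ext_inr.
Proof. by move=> a x y; congr pair; rewrite /= scaler0 addr0. Qed.
HB.instance Definition _ :=
  GRing.isLinear.Build _ _ _ _ torus_ext_inr torus_ext_inr_linear.

Definition torus_ext_emb : 'Hom(N, L) := linfun torus_ext_inr.
Local Notation I := (limg torus_ext_emb).

Lemma torus_ext_embE x : torus_ext_emb x = (0, x).
Proof. exact: lfunE. Qed.

Lemma torus_ext_embedding : lsa_embedding torus_ext_emb.
Proof.
split=> [|i x grx|x y]; rewrite ?torus_ext_embE.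
- apply/eqP; rewrite -subv0; apply/subvP => x.
  by rewrite memv_ker torus_ext_embE memv0 => /eqP[->].
- by apply/torus_ext_grP.
by congr pair; rewrite /= !zero_lfunE subrr add0r.
Qed.

Lemma mem_torus_ext_emb (p : L) : (p \in I) = (p.1 == 0).
Proof.
apply/memv_imgP/eqP => [[x _ ->]|]; first by rewrite torus_ext_embE.
by case: p => t x /= ->; exists x; rewrite ?memvf ?torus_ext_embE.
Qed.

Lemma torus_ext_brv_sub : (lsa_brv {: L} {: L} <= I)%VS.
Proof. by apply/lsa_brv_subP => u w _ _; rewrite mem_torus_ext_emb. Qed.

Lemma torus_ext_ideal : lsa_ideal I.
Proof.
split.
  apply/lsa_gradedP => i p; rewrite !mem_torus_ext_emb => /eqP p0.
  have odd1 : (parity_part true p).1 = 0.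
    by have /torus_ext_grP[_ ->] := parity_part_mem true p.
  case: i; first by rewrite odd1.
  by have := p0; rewrite -{1}(parity_partC true p) /= odd1 add0r => ->.
by apply: subv_trans torus_ext_brv_sub; rewrite brv_mono ?subvf.
Qed.

(** If a nilpotent ideal contained [(t, x)] with [t] nonzero, repeated brackets of an eigenvector of
    [t] with [(t, x)] would never vanish. *)
Lemma torus_ext_nilradical : lsa_nilradical I.
Proof.
split; first exact: torus_ext_ideal.
  exact: (lsa_nilpotent_limg torus_ext_embedding N_nilp).
move=> J J_ideal [m Jm0]; apply/subvP => -[t x] Jp.
rewrite mem_torus_ext_emb /=; apply/negPn/negP => t_neq0.
set p := (t, x) : L in Jp; have Tt := subvsP t.
have t_even := superderivation_even (T_torus.1 _ Tt).1.
have [e e_basis e_eigen] := (T_torus.1 _ Tt).2.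
have /hasP[v ev tv_neq0] : has (fun v => vsval t v != 0) e.
  apply: contraNT t_neq0 => /hasPn te0.
  apply/eqP/val_inj/(fullv_lfunP _ _ (span_basis e_basis)).
  by move=> v /te0/negPn/eqP ->; rewrite zero_lfunE.
have [a ta] := e_eigen v ev.
have [n Nn0] := N_nilp.
have v_neq0 : v != 0 by apply: contraNneq tv_neq0 => ->; rewrite linear0.
have a_neq0 : a != 0 by apply: contraNneq tv_neq0 => a0; rewrite ta a0 scale0r.
(* [k] is the exact depth of [v]: the error terms fall into layer [k.+1], but [v] does not. *)
have [k Ck Ck1] : exists2 k, v \in lcs {: N} k & v \notin lcs {: N} k.+1.
  have : v \notin lcs {: N} n by rewrite /lcs Nn0 memv0.
  elim: n {Nn0} => [|k IHk vk]; first by rewrite memvf.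
  by have [Ck|] := boolP (v \in lcs {: N} k); [exists k | apply: IHk].
pose q j : L := iter j (lsa_rad p) (torus_ext_emb v).
have qJ j : q j.+1 \in lcs J j.
  elim: j => [|j IHj]; rewrite /q iterS lsa_radE; first exact: ideal_brr.
  exact: lcs_br.
(* The sign comes from bracketing on the right: [[v, (t, x)] = - t v + [v, x]]. *)
have qv j : (q j).1 = 0 /\ (q j).2 - (- a) ^+ j *: v \in lcs {: N} k.+1.
  elim: j => [|j [q1 q2]]; first by rewrite /q /= torus_ext_embE scale1r subrr mem0v.
  rewrite {1 2}/q iterS -/(q j) lsa_radE; split=> //=.
  set c := _ - _ in q2; have -> : (q j).2 = c + (- a) ^+ j *: v by rewrite subrK.
  rewrite q1 /= zero_lfunE sub0r linearD linearZ /= ta brDl brZl.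
  have -> : - (vsval t c + (- a) ^+ j *: (a *: v)) +
      ([< c, x >] + (- a) ^+ j *: [< v, x >]) - (- a) ^+ j.+1 *: v =
      [< c, x >] + (- a) ^+ j *: [< v, x >] - vsval t c.
    by rewrite exprS; vector_ring.
  apply: memvB; last by apply: der_lcs => // *; apply: memvf.
  apply: memvD; first exact: lcs_brl.
  by apply/memvZ/lcs_br; rewrite ?memvf.
have := qJ m; rewrite /lcs Jm0 memv0 => /eqP qm0; case/negP: Ck1.
have [_] := qv m.+1; rewrite qm0 /= sub0r memvN => /(memvZ ((- a) ^+ m.+1)^-1).
by rewrite scalerA mulVf ?scale1r // expf_neq0 // oppr_eq0.
Qed.

Lemma torus_ext_solvable_extension : solvable_extension torus_ext_emb.
Proof.
split; [exact: torus_ext_embedding | | exact: torus_ext_nilradical].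
apply: lsa_solvable_derived torus_ext_brv_sub _.
exact: (lsa_nilpotent_limg torus_ext_embedding N_nilp).
Qed.

(** [h] is onto on N, so a bracket of two odd elements equals [h z0 = [h, z0]], a bracket of even
    ones. *)
Lemma torus_ext_conditions :
  (exists2 h, h \in T & forall v, h v - v \in lcs {: N} 1) ->
  extension_conditions torus_ext_emb.
Proof.
case=> h Th h1; split; first exact: torus_ext_brv_sub.
have [[h_gr h_br] _] := T_torus.1 h Th.
have h_even := superderivation_even (conj h_gr h_br).
apply/lsa_brv_subP => -[s x] [t y] /torus_ext_grP[/= grx /(_ isT) ->].
move=> /torus_ext_grP[/= gry /(_ isT) ->].
have [z _ hz] := shift_onto N_ideal h_even N_nilp (fun v _ => h1 v)
  (memvf [< x, y >]).
(* [h] preserves parity and [[x, y]] is even, so the even part of [z] is already a preimage. *)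
pose z0 := parity_part false z.
have hz0 : h z0 = [< x, y >].
  have hz1 : parity_part false (h (parity_part true z)) = 0.
    by apply: parity_part_eq0; exact: (h_gr true _ (parity_part_mem _ _)).
  rewrite -(parity_part_id (lsa_br_gr grx gry)) -hz.
  rewrite -[in RHS](parity_partC false z).
  by rewrite !linearD /= hz1 addr0
    (parity_part_id (h_gr _ _ (parity_part_mem _ _))).
rewrite (_ : torus_ext_br _ _ = [< (vsproj T h, 0) : L, (0, z0) : L >]).
  by apply: (@brv_mem _ L); apply/torus_ext_grP; rewrite /= ?mem0v ?parity_part_mem.
congr pair; rewrite /= vsprojK // !zero_lfunE !subr0 br0l.
by rewrite add0r addr0.
Qed.

Lemma torus_ext_codim : extension_codim torus_ext_emb = \dim T.
Proof.
rewrite /extension_codim limg_dim_eq; last first.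
  by have [-> _ _] := torus_ext_embedding; rewrite capv0.
by rewrite !dimvf; apply: addnK.
Qed.

End TorusExtensionProperties.

Theorem corollary4p11 (R : realType) (N L : lieSuperalgebra R[i])
    (f : 'Hom(N, L))
    (N_nilpotent : lsa_nilpotent {: N})
    (N_maximal_rank : lsa_maximal_rank N)
    (L_maximal : maximal_solvable_extension f)
    (L_conditions : extension_conditions f)
    (L_not_nilpotent : ~ lsa_nilpotent {: L}) :
  lsa_center_trivial L /\
  forall d : 'End(L), superderivation d -> inner_superderivation d.
Proof.
have [[f_emb _ I_nilrad] L_max] := L_maximal.
have [LL_I _] := L_conditions.
have [T [T_torus _] dimT] := N_maximal_rank.
have T_ext := torus_ext_solvable_extension T_torus N_nilpotent.
have T_cond : extension_conditions (torus_ext_emb T_torus).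
  apply: torus_ext_conditions (N_nilpotent) _.
  exact: (maximal_rank_shift N_nilpotent T_torus (eq_leq (esym dimT))).
have := L_max _ _ T_ext T_cond; rewrite torus_ext_codim dimT => codim_le.
apply: (nilradical_complete I_nilrad LL_I).
(* [f] is injective and maps the lower central series of N onto that of its image, so dim N/[N, N]
   may be computed inside L. *)
have f_ker (U : {vspace N}) : \dim (f @: U)%VS = \dim U.
  by apply: limg_dim_eq; have [-> _ _] := f_emb; rewrite capv0.
by rewrite /extension_codim f_ker in codim_le; rewrite -(limg_lcs f_emb) !f_ker.
Qed.
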